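(* Suppose that $\Lambda_1+\cdots+\Lambda_n=2m$ for some positive integer $m$, and let $(a,w_1,\dots,w_m)\in\mathbb C^{m+1}$ be a solution of the system of Bethe ansatz equations \[A_+(w_i)\prod_{j:j\neq i}\theta(w_i-w_j-2\eta)=e^{4a\eta}A_-(w_i)\prod_{j:j\neq i}\theta(w_i-w_j+2\eta),\qquad i=1,\dots,m,\] such that $w_i\ne w_j\bmod\Gamma$ for $i\neq j$. Then $u(x_1,\dots,x_n)=\prod_{i=1}^nQ(x_i)$ with $Q(x)=e^{ax}\prod_{k=1}^m\theta(x-w_k)$ is a common eigenfunction of the operators $T(z)$, $z\in\mathbb C$.
   Context: Let $\mathrm{Im}\,\tau>0$, $\Gamma=\mathbb Z+\tau\mathbb Z$, $\eta\in\mathbb C$, $\theta(z)=-\sum_{j\in\mathbb Z}\exp(i\pi(j+\frac12)^2\tau+2\pi i(j+\frac12)(z+\frac12))$. Let $z_1,\dots,z_n\in\mathbb C$ be distinct, $\Lambda_1,\dots,\Lambda_n\in\mathbb Z_{\ge0}$, and $A_\pm(x)=\prod_{k=1}^n\theta(x+z_k\pm\eta\Lambda_k)$. The operator $T(z)$ acts on meromorphic functions $u$ of $x_1,\dots,x_n\in\mathbb C$ by \[T(-z)u(x_1,\dots,x_n)=\sum_{i=1}^n\frac{\theta(\lambda-z+x_i)}{\theta(\lambda)}\prod_{j\ne i}\frac{\theta(z-x_j)}{\theta(x_i-x_j)}\Bigl(A_+(x_i)u(x_1,\dots,x_i-2\eta,\dots,x_n)+A_-(x_i)u(x_1,\dots,x_i+2\eta,\dots,x_n)\Bigr),\]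 where $\lambda=-\sum_{k=1}^n(x_k+z_k)$. A common eigenfunction is a non-zero $u$ with $T(z)u=\epsilon(z)u$ for all $z\in\mathbb C$, for some scalar function $\epsilon(z)$. *)

(* Defs.v *)
From HB Require Import structures.
From mathcomp Require Import all_boot all_order all_algebra.
From mathcomp Require Import all_classical all_reals all_analysis.
From mathcomp Require Import complex.

Set Implicit Arguments.
Unset Strict Implicit.
Unset Printing Implicit Defensive.

Import Order.TTheory GRing.Theory Num.Theory.
Import numFieldNormedType.Exports.

Local Open Scope classical_set_scope.
Local Open Scope complex_scope.
Local Open Scope ring_scope.

(* R[i] with its numClosedFieldType structure made explicit: the topology and
   the norm are inferred from a num field, not from the bare type complex R. *)
Definition Cplx (R : realType) : numClosedFieldType := R[i].

Section ComplexFunctions.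
Variable R : realType.
Local Notation C := (Cplx R).

Definition cexp (z : C) : C :=
  (expR (complex.Re z) * cos (complex.Im z))
    +i* (expR (complex.Re z) * sin (complex.Im z)).

Definition ipi : C := 0 +i* pi.

(* Sum over all integers, as the sum of the two one-sided series
   (j >= 0 and j <= -1). *)
Definition sum_int (f : int -> C) : C :=
  limn (series (fun k : nat => f k%:Z))
  + limn (series (fun k : nat => f (- k.+1%:Z))).

Definition theta (tau z : C) : C :=
  - sum_int (fun j : int =>
      cexp (ipi * (j%:~R + 2^-1) ^+ 2 * tau
            + 2 * ipi * (j%:~R + 2^-1) * (z + 2^-1))).

Definition lattice (tau : C) : set C :=
  [set c | exists p q : int, c = p%:~R + q%:~R * tau].

End ComplexFunctions.

Section Meromorphic.
Variables (R : realType) (n : nat).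
Local Notation C := (Cplx R).

Definition holomorphic_at (f : 'rV[C]_n -> C) (p : 'rV[C]_n) : Prop :=
  \forall x \near p, differentiable f x.

(* A meromorphic function on C^n is represented by a total function whose
   values on the polar divisor are irrelevant: locally it is a quotient g / h
   of holomorphic functions wherever h does not vanish, the germ of h being
   nonzero.  Two such functions are identified when they satisfy mero_eq. *)
Definition meromorphic (f : 'rV[C]_n -> C) : Prop :=
  forall p : 'rV[C]_n, exists g h : 'rV[C]_n -> C,
    [/\ holomorphic_at g p, holomorphic_at h p,
        ~ (\forall x \near p, h x = 0)
      & \forall x \near p, h x != 0 -> f x = g x / h x].

Definition mero_eq (f g : 'rV[C]_n -> C) : Prop :=
  exists U : set 'rV[C]_n,
    [/\ open U, dense U & forall x, U x -> f x = g x].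

End Meromorphic.

Section TransferMatrix.
Variables (R : realType) (n : nat).
Local Notation C := (Cplx R).
Variables (tau eta : C) (z : 'I_n -> C) (Lambda : 'I_n -> nat).

Definition A_plus (x : C) : C :=
  \prod_(k < n) theta tau (x + z k + eta * (Lambda k)%:R).

Definition A_minus (x : C) : C :=
  \prod_(k < n) theta tau (x + z k - eta * (Lambda k)%:R).

Definition shift_coord (x : 'rV[C]_n) (i : 'I_n) (h : C) : 'rV[C]_n :=
  x + h *: delta_mx 0 i.

Definition lam (x : 'rV[C]_n) : C := - \sum_(k < n) (x 0 k + z k).

(* transfer_opp y is the operator T(-y); its coefficients are written with y. *)
Definition transfer_opp (y : C) (u : 'rV[C]_n -> C) (x : 'rV[C]_n) : C :=
  \sum_(i < n)
    theta tau (lam x - y + x 0 i) / theta tau (lam x)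
    * (\prod_(j < n | j != i)
         (theta tau (y - x 0 j) / theta tau (x 0 i - x 0 j)))
    * (A_plus (x 0 i) * u (shift_coord x i (- (2 * eta)))
       + A_minus (x 0 i) * u (shift_coord x i (2 * eta))).

Definition transfer (y : C) : ('rV[C]_n -> C) -> 'rV[C]_n -> C :=
  transfer_opp (- y).

Definition common_eigenfunction (u : 'rV[C]_n -> C) : Prop :=
  [/\ meromorphic u,
      ~ mero_eq u (fun=> 0)
    & exists eps : C -> C,
        forall y : C, mero_eq (transfer y u) (fun x => eps y * u x)].

End TransferMatrix.

Section Bethe.
Variables (R : realType) (n m : nat).
Local Notation C := (Cplx R).
Variables (tau eta : C) (z : 'I_n -> C) (Lambda : 'I_n -> nat).

Definition bethe_equations (a : C) (w : 'I_m -> C) : Prop :=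
  forall i : 'I_m,
    A_plus tau eta z Lambda (w i)
      * \prod_(j < m | j != i) theta tau (w i - w j - 2 * eta)
    = cexp (4 * a * eta) * A_minus tau eta z Lambda (w i)
      * \prod_(j < m | j != i) theta tau (w i - w j + 2 * eta).

Definition Qfun (a : C) (w : 'I_m -> C) (x : C) : C :=
  cexp (a * x) * \prod_(k < m) theta tau (x - w k).

End Bethe.

(* Main.v *)
Require Import Defs.
From mathcomp Require Import all_boot all_order all_algebra.
From mathcomp Require Import all_classical all_reals all_analysis.
From mathcomp Require Import complex zify ring lra.

Import Order.TTheory GRing.Theory Num.Theory.
Import numFieldNormedType.Exports.

Local Open Scope classical_set_scope.
Local Open Scope complex_scope.
Local Open Scope ring_scope.

Set Implicit Arguments.
Unset Strict Implicit.
Unset Printing Implicit Defensive.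

(** Put [Q v = cexp (a * v) * q v] with [q v] the product of the
    [theta (v - w k)].  Baxter's expression
    [A_plus v * Q (v - 2 eta) + A_minus v * Q (v + 2 eta)] equals
    [cexp (a * v) * psi v], where [psi] is [baxter_num] below, and the Bethe
    equations make [psi] vanish at every [w k]
    ([baxter_num_root]).  Applied to the product of the [Q (x i)], the operator
    [T (- y)] therefore multiplies it by the Lagrange interpolation formula, with
    nodes [x i], of the function [psi / q] at [y], so the claim is that theta
    interpolation reproduces [psi / q].  Dividing out, this says that the residues
    of an elliptic function with simple poles at [y], the [x i] and the [w k] add
    up to zero, the residues at the [w k] being zero by the Bethe equations
    ([transfer_generic]).  Ellipticity is a condition on the sum of the zeros, and
    it holds because the [Lambda k] add up to [2 m].

    No theory of elliptic functions is needed for the residue theorem: it is the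
    partial fraction identity [theta_residue_sum_eq0], which follows by induction
    from Weierstrass' three-term relation [theta_three_term].  The latter is a
    Pluecker relation, because [theta (x + y) * theta (x - y)] is a two by two
    minor built from two theta functions for [2 tau] ([theta_mul_addsub]), and this
    in turn is a rearrangement of a double series.

    The remaining input is that theta vanishes only on the lattice
    ([theta_eq0_lattice]).  It makes [theta (w i - w j)] non-zero, and makes the
    points at which all denominators are non-zero dense.  It comes from the Jacobi
    triple product, obtained as a limit of the q-binomial theorem by dominated
    convergence: the partial products stay away from zero.

    For fixed [y] the interpolation argument excludes the [x] with [x i] in
    [y + lattice], and it excludes all [x] if [y] is in [w k + lattice].  The
    eigenvalue is therefore defined as the quotient at a fixed generic point, and
    [transfer_proportional] extends the eigenvalue equation to all [y] by
    continuity in [y]. *)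

(** * Complex numbers as pairs of reals *)

Section ComplexBasics.
Variable R : realType.
Local Notation C := (Cplx R).
Implicit Types (x y : C) (k : R).

Lemma ReD x y : complex.Re (x + y) = complex.Re x + complex.Re y.
Proof. by case: x; case: y. Qed.

Lemma ImD x y : complex.Im (x + y) = complex.Im x + complex.Im y.
Proof. by case: x; case: y. Qed.

Lemma ReN x : complex.Re (- x) = - complex.Re x.
Proof. by case: x. Qed.

Lemma ImN x : complex.Im (- x) = - complex.Im x.
Proof. by case: x. Qed.

Lemma ReM x y : complex.Re (x * y) =
  complex.Re x * complex.Re y - complex.Im x * complex.Im y.
Proof. by case: x; case: y. Qed.

Lemma ImM x y : complex.Im (x * y) =
  complex.Re x * complex.Im y + complex.Im x * complex.Re y.
Proof. by case: x => a b; case: y => c d /=. Qed.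

Lemma complex_eqP x y :
  complex.Re x = complex.Re y -> complex.Im x = complex.Im y -> x = y.
Proof. by case: x => a b; case: y => c d /= -> ->. Qed.

Lemma norm_i : `|'i%C| = 1 :> C.
Proof. by rewrite normc_def /= expr0n expr1n add0r sqrtr1. Qed.

Lemma norm_le_ReIm x :
  `|x| <= (`|complex.Re x| + `|complex.Im x|)%:C :> C.
Proof.
case: x => a b /=.
have -> : a +i* b = a%:C + 'i%C * b%:C :> R[i].
  by rewrite [LHS]complexE.
apply: (le_trans (ler_normD _ _)).
by rewrite normrM norm_i mul1r !normc_def /= !expr0n /= !addr0 !sqrtr_sqr -rmorphD.
Qed.

Lemma norm_Re_le x k : `|x| <= k%:C -> `|complex.Re x| <= k.
Proof.
by move=> xk; rewrite -lecR (le_trans _ xk)// normc_ge_Re.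
Qed.

Lemma norm_Im_le x k : `|x| <= k%:C -> `|complex.Im x| <= k.
Proof.
move=> xk; rewrite -normrN -ReiNIm; apply: norm_Re_le.
by rewrite normrM norm_i mulr1.
Qed.

Lemma real_of_ge0 x : 0 <= x -> x = (complex.Re x)%:C.
Proof. by move=> x0; rewrite RRe_real// ger0_real. Qed.

Lemma cvg_complex (T : Type) (F : set_system T) {FF : Filter F}
    (f g : T -> R) (a b : R) :
  f @ F --> a -> g @ F --> b -> (fun t => (f t +i* g t : C)) @ F --> (a +i* b : C).
Proof.
move=> fa gb; apply/cvgrPdist_le => e e0.
have eE := real_of_ge0 (ltW e0).
have e1 : 0 < complex.Re e by rewrite -ltcR -eE.
have e2 : 0 < complex.Re e / 2 by rewrite divr_gt0.
move/cvgrPdist_le : fa => /(_ _ e2) fa; move/cvgrPdist_le : gb => /(_ _ e2) gb.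
near=> t.
apply: (le_trans (norm_le_ReIm _)); rewrite eE lecR /=.
rewrite [leRHS]splitr; apply: lerD.
  by near: t.
by near: t.
Unshelve. all: by end_near. Qed.

End ComplexBasics.

(** * Series over the integers *)

Section GeometricSums.
Variable R : realType.
Local Notation C := (Cplx R).
Implicit Types (f g : int -> C) (K : C).

Lemma half_exp_cvg0 (K : C) : (fun n => K * 2^-1 ^+ n : C) @ \oo --> (0 : C).
Proof.
have c : (fun n : nat => ((2^-1 : R) ^+ n) +i* 0 : C) @ \oo --> (0 +i* 0 : C).
  apply: cvg_complex; last exact: cvg_cst.
  by apply: cvg_expr; rewrite ger0_norm ?invr_ge0// invf_lt1 ?ltr1n//.
have -> : (fun n => K * 2^-1 ^+ n : C) = (fun n => K * (2^-1 ^+ n +i* 0)).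
  apply/funext => n; congr (_ * _).
  have -> : (2^-1 : C) = (2^-1 : R)%:C by rewrite fmorphV rmorphMn.
  by rewrite -[LHS]rmorphXn.
rewrite -[X in _ --> X](mulr0 K); exact: cvgM (cvg_cst K) c.
Qed.

Lemma series_geometric_cvg (u : nat -> C) (K r : R) : 0 <= r -> r < 1 ->
  (forall k, `|u k| <= (K * r ^+ k)%:C) -> cvgn (series u).
Proof.
move=> r0 r1 uK.
have cv (v : nat -> R) : (forall k, `|v k| <= K * r ^+ k) -> cvgn (series v).
  move=> vK; apply: normed_cvg.
  apply: (@series_le_cvg _ _ (fun k => K * r ^+ k)) => [k|k|k|] /=.
  - exact: normr_ge0.
  - exact: (le_trans (normr_ge0 _) (vK k)).
  - exact: vK.
  by apply: is_cvg_geometric_series; rewrite ger0_norm.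
have /cvg_ex[a ca] := cv (@complex.Re R \o u) (fun k => norm_Re_le (uK k)).
have /cvg_ex[b cb] := cv (@complex.Im R \o u) (fun k => norm_Im_le (uK k)).
apply/cvg_ex; exists (a +i* b : C).
suff -> : series u = (fun n => series (@complex.Re R \o u) n +i*
    series (@complex.Im R \o u) n : C) by exact: cvg_complex ca cb.
apply/funext => n.
rewrite !seriesEord /=; apply: complex_eqP => /=.
- by rewrite (big_morph (@complex.Re R : C -> R) (@ReD R) (erefl : complex.Re (0 : C) = 0)).
- by rewrite (big_morph (@complex.Im R : C -> R) (@ImD R) (erefl : complex.Im (0 : C) = 0)).
Qed.

Lemma series_half_cvg (u : nat -> C) K :
  (forall k, `|u k| <= K * 2^-1 ^+ k) -> cvgn (series u).
Proof.
move=> uK.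
have K0 : 0 <= K.
  by have := uK 0%N; rewrite expr0 mulr1; apply: le_trans.
apply: (@series_geometric_cvg _ (complex.Re K) 2^-1) => [||k].
- by rewrite invr_ge0.
- by rewrite invf_lt1 ?ltr1n.
- apply: (le_trans (uK k)); rewrite rmorphM rmorphXn fmorphV rmorphMn /=.
  by rewrite -real_of_ge0.
Qed.

Lemma sum_half (n : nat) : \sum_(k < n) (2^-1 : C) ^+ k <= 2.
Proof.
suff -> : \sum_(k < n) (2^-1 : C) ^+ k = 2 - 2 * 2^-1 ^+ n.
  by rewrite lerBlDr lerDl mulr_ge0// exprn_ge0// invr_ge0.
elim: n => [|n IH]; first by rewrite big_ord0 expr0; ring.
by rewrite big_ord_recr /= IH exprS; field.
Qed.

(** Symmetric partial sums, over [- n <= j < n].  The two one-sided series of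
    [sum_int] advance together, so that shifts and the reflection [j -> - 1 - j]
    can be carried out on finite sums. *)
Definition psum f (n : nat) : C :=
  \sum_(k < n) (f k%:Z + f (- k.+1%:Z)).

(** Decay like [2 ^ -|j|]: every series below has Gaussian terms, so this single
    rate of summability is enough and is stable under all rearrangements. *)
Definition decay (j : int) : C := 2^-1 ^+ `|j|%N.

Definition bounded_by K f := forall j, `|f j| <= K * decay j.

Lemma decay_ge0 j : 0 <= decay j.
Proof. by rewrite exprn_ge0// invr_ge0. Qed.

Lemma bounded_ge0 K f : bounded_by K f -> 0 <= K.
Proof.
by move=> /(_ 0); rewrite /decay /= expr0 mulr1; apply: le_trans.
Qed.

Lemma bounded_nat K f (k : nat) : bounded_by K f -> `|f k%:Z| <= K * 2^-1 ^+ k.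
Proof. by move=> /(_ k%:Z). Qed.

Lemma bounded_neg K f (k : nat) : bounded_by K f -> `|f (- k.+1%:Z)| <= K * 2^-1 ^+ k.
Proof.
move=> fK; apply: (le_trans (fK _)); apply: ler_wpM2l; first exact: bounded_ge0 fK.
rewrite /decay abszN absz_nat exprS ler_piMl// ?exprn_ge0 ?invr_ge0//.
by rewrite invf_le1 ?ler1n.
Qed.

Lemma psum_cvg K f : bounded_by K f -> psum f @ \oo --> sum_int f.
Proof.
move=> fK.
have c1 : cvgn (series (fun k : nat => f k%:Z)).
  by apply: (@series_half_cvg _ K) => k; exact: bounded_nat.
have c2 : cvgn (series (fun k : nat => f (- k.+1%:Z))).
  by apply: (@series_half_cvg _ K) => k; exact: bounded_neg.
suff -> : psum f = (fun n => series (fun k : nat => f k%:Z) n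
    + series (fun k : nat => f (- k.+1%:Z)) n) by exact: cvgD c1 c2.
by apply/funext => n; rewrite /psum big_split !seriesEord.
Qed.

(** The factor 4 is 2 for the two terms of index [k] times 2 for the geometric
    series. *)
Lemma psum_tail K f (m n : nat) : (m <= n)%N -> bounded_by K f ->
  `|psum f n - psum f m| <= 4 * K * 2^-1 ^+ m.
Proof.
move=> mn fK; have K0 := bounded_ge0 fK.
rewrite /psum -!(big_mkord xpredT (fun k : nat => f k%:Z + f (- k.+1%:Z))).
rewrite (big_cat_nat _ mn)//= addrAC subrr add0r -{1}(add0n m) big_addn big_mkord.
apply: (le_trans (ler_norm_sum _ _ _)).
apply: (@le_trans _ _ (\sum_(i < n - m) 2 * K * 2^-1 ^+ m * 2^-1 ^+ i)).
  apply: ler_sum => i _; apply: (le_trans (ler_normD _ _)).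
  have := lerD (bounded_nat (i + m) fK) (bounded_neg (i + m) fK).
  by move/le_trans; apply; rewrite exprD -subr_ge0 le_eqVlt; apply/orP; left; apply/eqP; ring.
rewrite -mulr_sumr (_ : 4 * K * _ = 2 * K * 2^-1 ^+ m * 2); last by ring.
apply: ler_wpM2l; last exact: sum_half.
by rewrite !mulr_ge0// exprn_ge0// invr_ge0.
Qed.

Lemma psum_bound K f n : bounded_by K f -> `|psum f n| <= 4 * K.
Proof.
move=> fK; have := psum_tail (leq0n n) fK.
by rewrite {2}/psum big_ord0 subr0 expr0 mulr1.
Qed.

Lemma sum_int_tail K f (m : nat) : bounded_by K f ->
  `|sum_int f - psum f m| <= 4 * K * 2^-1 ^+ m.
Proof.
move=> fK.
apply/ler_addgt0Pr => e e0.
have /cvgrPdist_le/(_ _ e0) near_sum := psum_cvg fK.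
near \oo => n.
rewrite [leRHS]addrC (_ : sum_int f - psum f m = (sum_int f - psum f n) + (psum f n - psum f m)).
  apply: (le_trans (ler_normD _ _)); apply: lerD; first by near: n.
  by apply: psum_tail => //; near: n; exact: nbhs_infty_ge.
by rewrite addrA subrK.
Unshelve. all: by end_near. Qed.

Lemma sum_int_bound K f : bounded_by K f -> `|sum_int f| <= 4 * K.
Proof.
move=> fK; have := sum_int_tail 0 fK.
by rewrite {1}/psum big_ord0 subr0 expr0 mulr1.
Qed.

(** Rearrangements are proved by comparing partial sums with an explicit error,
    which avoids passing to the limit along each rearranged family. *)
Lemma eq_of_half_bound (x y K : C) :
  (forall n : nat, `|x - y| <= K * 2^-1 ^+ n) -> x = y.
Proof.
move=> xyK; apply/eqP; rewrite -subr_eq0 -normr_le0.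
apply/ler_addgt0Pr => e e0; rewrite add0r.
have /cvgrPdist_le/(_ _ e0) := half_exp_cvg0 K.
move=> [n _ /(_ n (leqnn n))] /=; rewrite sub0r normrN; apply: le_trans.
by apply: (le_trans (xyK n)); apply: real_ler_norm; rewrite ger0_real// (le_trans _ (xyK n)).
Qed.

Lemma eq_sum_int f g : f =1 g -> sum_int f = sum_int g.
Proof. by move=> /funext ->. Qed.

Lemma psumD f g n : psum (fun j => f j + g j) n = psum f n + psum g n.
Proof. by rewrite /psum -big_split; apply: eq_bigr => i _; rewrite /= addrACA. Qed.

Lemma psumZ c f n : psum (fun j => c * f j) n = c * psum f n.
Proof. by rewrite /psum big_distrr; apply: eq_bigr => i _; rewrite /= mulrDr. Qed.

Lemma psumB f g n : psum (fun j => f j - g j) n = psum f n - psum g n.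
Proof.
rewrite -[in RHS]mulN1r -psumZ -psumD; congr psum.
by apply/funext => j; rewrite mulN1r.
Qed.

Lemma boundedD K K' f g : bounded_by K f -> bounded_by K' g ->
  bounded_by (K + K') (fun j => f j + g j).
Proof.
move=> fK gK j; apply: (le_trans (ler_normD _ _)).
by rewrite mulrDl lerD.
Qed.

Lemma boundedZ K c f : bounded_by K f -> bounded_by (`|c| * K) (fun j => c * f j).
Proof. by move=> fK j; rewrite normrM -mulrA ler_wpM2l. Qed.

Lemma sum_intD K K' f g : bounded_by K f -> bounded_by K' g ->
  sum_int (fun j => f j + g j) = sum_int f + sum_int g.
Proof.
move=> fK gK; apply: (cvg_unique _ (psum_cvg (boundedD fK gK))) => //.
rewrite (_ : psum _ = psum f \+ psum g); last by apply/funext => n; exact: psumD.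
by apply: cvgD; [exact: psum_cvg fK|exact: psum_cvg gK].
Qed.

Lemma sum_intZ K c f : bounded_by K f -> sum_int (fun j => c * f j) = c * sum_int f.
Proof.
move=> fK; apply: (cvg_unique _ (psum_cvg (boundedZ c fK))) => //.
rewrite (_ : psum _ = (fun n => c * psum f n)); last by apply/funext => n; exact: psumZ.
by apply: cvgMr; exact: psum_cvg fK.
Qed.

Lemma sum_int_reflect f : sum_int (fun j => f (- j - 1)) = sum_int f.
Proof.
rewrite /sum_int addrC; congr (_ + _); congr (limn (series _)); apply/funext => k;
  congr f; lia.
Qed.

Lemma decay_le (j k : int) : (`|k| <= `|j|)%N -> decay j <= decay k.
Proof.
by move=> kj; rewrite /decay ler_wiXn2l ?invr_ge0// invf_le1// ler1n.
Qed.

Lemma decay_mul_le (j k : int) : decay j * decay k <= decay (j + k).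
Proof.
rewrite /decay -exprD ler_wiXn2l ?invr_ge0// ?invf_le1// ?ler1n//; lia.
Qed.

Lemma decay_half (j : int) (n : nat) : (n <= `|j|)%N -> decay j <= 2^-1 ^+ n.
Proof. by move=> nj; rewrite ler_wiXn2l ?invr_ge0// invf_le1 ?ler1n. Qed.

Lemma bounded_shift K f (m : int) : bounded_by K f ->
  bounded_by (K * 2 ^+ `|m|%N) (fun j => f (j + m)).
Proof.
move=> fK j; apply: (le_trans (fK _)).
rewrite -mulrA; apply: ler_wpM2l; first exact: bounded_ge0 fK.
have := decay_mul_le (j + m) (- m); rewrite addrK.
move=> /(ler_wpM2l (exprn_ge0 `|m|%N (ler0n C 2))); apply: le_trans.
rewrite mulrCA [X in _ * X](_ : _ = 1) ?mulr1// /decay abszN -exprMn_comm ?divff ?expr1n//.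
exact: mulrC.
Qed.

(** The two partial sums differ by the boundary terms [f n - f (- n)] only. *)
Lemma sum_int_shift1 K f : bounded_by K f -> sum_int (fun j => f (j + 1)) = sum_int f.
Proof.
move=> fK; have K0 := bounded_ge0 fK.
have f1K := bounded_shift 1 fK.
(* 14 = 8 + 2 + 4: tail of the shifted series, boundary terms, tail of f. *)
apply: (@eq_of_half_bound _ _ (14 * K)) => n.
set f1 := (fun j => _).
have tel : psum f1 n - psum f n = f n%:Z - f (- n%:Z).
  rewrite -psumB /psum -(big_mkord xpredT (fun k : nat =>
    (f1 k%:Z - f k%:Z) + (f1 (- k.+1%:Z) - f (- k.+1%:Z)))).
  rewrite (@telescope_sumr_eq _ 0%N n (fun k : nat => f k%:Z - f (- k%:Z)))//.
    by rewrite oppr0 subrr subr0.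
  move=> k _; rewrite /f1.
  rewrite (_ : k%:Z + 1 = k.+1%:Z); last lia.
  rewrite (_ : - k.+1%:Z + 1 = - k%:Z); last lia.
  by ring.
rewrite (_ : _ - _ = (sum_int f1 - psum f1 n)
  + ((psum f1 n - psum f n) - (sum_int f - psum f n))); last by ring.
rewrite (_ : 14 * K * _ = 4 * (K * 2 ^+ `|1|%N) * 2^-1 ^+ n
   + ((K * 2^-1 ^+ n + K * 2^-1 ^+ n) + 4 * K * 2^-1 ^+ n)); last by rewrite expr1; ring.
apply: (le_trans (ler_normD _ _)); apply: lerD; first exact: sum_int_tail.
apply: (le_trans (ler_normB _ _)); apply: lerD; last exact: sum_int_tail.
rewrite tel; apply: (le_trans (ler_normB _ _)); apply: lerD;
  by apply: (le_trans (fK _)); rewrite ler_wpM2l// decay_half//; lia.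
Qed.

Lemma sum_int_shift K f (m : int) : bounded_by K f ->
  sum_int (fun j => f (j + m)) = sum_int f.
Proof.
move=> fK; elim/int_ind: m => [|n IH|n IH].
- by apply: eq_sum_int => j; rewrite addr0.
- rewrite -[RHS]IH -[RHS](sum_int_shift1 (bounded_shift n fK)).
  by apply: eq_sum_int => j; congr f; lia.
- rewrite -[RHS]IH -[LHS](sum_int_shift1 (bounded_shift (- n.+1%:Z) fK)).
  by apply: eq_sum_int => j; congr f; lia.
Qed.

Lemma sum_int_parity K f : bounded_by K f ->
  sum_int f = sum_int (fun j => f (2 * j)) + sum_int (fun j => f (2 * j + 1)).
Proof.
move=> fK; have K0 := bounded_ge0 fK.
have feK : bounded_by K (fun j => f (2 * j)).
  move=> j; apply: (le_trans (fK _)); apply: ler_wpM2l => //; apply: decay_le; lia.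
have foK : bounded_by K (fun j => f (2 * j + 1)).
  move=> j; apply: (le_trans (fK _)); apply: ler_wpM2l => //; apply: decay_le; lia.
rewrite -(sum_intD feK foK).
(* 12 = 4 + 8: tail of f, tail of the sum of its two halves. *)
apply: (@eq_of_half_bound _ _ (12 * K)) => n.
have dbl : psum f n.*2 = psum (fun j => f (2 * j) + f (2 * j + 1)) n.
  elim: n => [|n IH]; first by rewrite /psum !big_ord0.
  rewrite doubleS /psum !big_ord_recr /= -/(psum _ _) IH /psum -!addrA; congr (_ + _).
  rewrite (_ : 2 * n%:Z = n.*2%:Z); last lia.
  rewrite (_ : n.*2%:Z + 1 = n.*2.+1%:Z); last lia.
  rewrite (_ : 2 * - n.+1%:Z = - n.*2.+2%:Z); last lia.
  rewrite (_ : - n.*2.+2%:Z + 1 = - n.*2.+1%:Z); last lia.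
  by ring.
rewrite (_ : _ - _ = (sum_int f - psum f n.*2)
  - (sum_int (fun j => f (2 * j) + f (2 * j + 1)) - psum f n.*2)); last by ring.
apply: (le_trans (ler_normB _ _)); rewrite {2}dbl.
apply: le_trans (lerD (sum_int_tail _ fK) (sum_int_tail _ (boundedD feK foK))) _.
have h : (2^-1 : C) ^+ n.*2 <= 2^-1 ^+ n.
  by rewrite ler_wiXn2l ?invr_ge0// ?invf_le1 ?ler1n// -addnn leq_addr.
rewrite (_ : 12 * K * _ = 4 * K * 2^-1 ^+ n + 4 * (K + K) * 2^-1 ^+ n); last by ring.
by rewrite lerD// ler_wpM2l// mulr_ge0.
Qed.

Section Exchange.
Variables (K : C) (F : int -> int -> C).
Hypothesis FK : forall j k, `|F j k| <= K * decay j * decay k.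

(** 32 = 16 + 16: truncation of the outer sum, and of all the inner ones. *)
Lemma iterated_sum_approx n :
  `|sum_int (fun j => sum_int (F j)) - psum (fun j => psum (F j) n) n| <=
    32 * K * 2^-1 ^+ n.
Proof.
have rowK j : bounded_by (K * decay j) (F j) by move=> k; exact: FK.
have HK : bounded_by (4 * K) (fun j => sum_int (F j)).
  by move=> j; have := sum_int_bound (rowK j); rewrite mulrA.
have DK : bounded_by (4 * K * 2^-1 ^+ n) (fun j => sum_int (F j) - psum (F j) n).
  move=> j; have := sum_int_tail n (rowK j).
  by rewrite (_ : 4 * (K * _) * _ = 4 * K * 2^-1 ^+ n * decay j)//; ring.
have := psum_bound n DK; rewrite psumB.
set S := sum_int _; set P := psum _ n; set P' := psum _ n => PP'.
rewrite (_ : S - P' = (S - P) + (P - P')); last by ring.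
apply: (le_trans (ler_normD _ _)).
apply: (le_trans (lerD (sum_int_tail n HK) PP')).
by rewrite le_eqVlt; apply/orP; left; apply/eqP; ring.
Qed.

End Exchange.

(** Both iterated sums have the same square partial sums. *)
Lemma sum_int_exchange K (F : int -> int -> C) :
  (forall j k, `|F j k| <= K * decay j * decay k) ->
  sum_int (fun j => sum_int (F j)) = sum_int (fun k => sum_int (F^~ k)).
Proof.
move=> FK; apply: (@eq_of_half_bound _ _ (64 * K)) => n.
have FK' j k : `|F^~ j k| <= K * decay j * decay k by rewrite mulrAC FK.
have := lerD (iterated_sum_approx FK n) (iterated_sum_approx FK' n).
rewrite -!mulrDl -natrD; apply: le_trans.
have -> : psum (fun j => psum (F j) n) n = psum (fun j => psum (F^~ j) n) n.
  rewrite /psum; under eq_bigr do rewrite -big_split /=.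
  rewrite exchange_big; apply: eq_bigr => i _; rewrite -big_split.
  by apply: eq_bigr => j _; exact: addrACA.
rewrite [X in _ <= _ + X]distrC; exact: ler_distD.
Qed.

(** Dominated convergence, the range of summation growing with the terms. *)
Lemma tannery K (F : nat -> int -> C) f :
  (forall n j, `|F n j| <= K * decay j) -> bounded_by K f ->
  (forall j, (fun n => F n j) @ \oo --> f j) ->
  (fun n => psum (F n) n) @ \oo --> sum_int f.
Proof.
move=> FK fK Ff; have K0 := bounded_ge0 fK.
apply/cvgrPdist_le => e e0.
have e3 : 0 < e / 3 by rewrite divr_gt0.
have /cvgrPdist_le/(_ _ e3)[m _ /(_ m (leqnn m))] := half_exp_cvg0 (4 * K).
rewrite /= sub0r normrN ger0_norm ?mulr_ge0 ?exprn_ge0 ?invr_ge0// => me.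
have c : (fun n => psum (F n) m) @ \oo --> psum f m.
  by apply: cvg_big => [|k _]; [exact: add_continuous|exact: cvgD].
move/cvgrPdist_le : c => /(_ _ e3) c.
near=> n.
rewrite (_ : _ - _ = (sum_int f - psum f m) + ((psum f m - psum (F n) m)
   - (psum (F n) n - psum (F n) m))); last by ring.
rewrite (_ : e = e / 3 + (e / 3 + e / 3)); last by field.
apply: (le_trans (ler_normD _ _)); apply: lerD.
  exact: le_trans (sum_int_tail _ fK) me.
apply: (le_trans (ler_normB _ _)); apply: lerD; first by near: n.
apply: le_trans me; apply: psum_tail; last exact: FK.
by near: n; exact: nbhs_infty_ge.
Unshelve. all: by end_near. Qed.

End GeometricSums.

(** * Quadratic remainders of the real exponential and trigonometric functions *)

Section RealBounds.
Variable R : realType.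
Implicit Types t : R.

Lemma expR_sub1_le t : `|expR t - 1| <= `|t| * expR `|t|.
Proof.
have [t0|t0] := leP 0 t.
- have := expR_ge1Dx (- t); rewrite expRN => h.
  rewrite ger0_norm ?(ger0_norm t0); last first.
    by rewrite subr_ge0 (le_trans _ (expR_ge1Dx t))// lerDl.
  have := ler_wpM2r (expR_ge0 t) h; rewrite mulVf ?expR_eq0//; lra.
- rewrite ler0_norm; last by rewrite subr_le0 expR_le1 ltW.
  have := expR_ge1Dx t => h.
  apply: (@le_trans _ _ `|t|); first by rewrite ltr0_norm//; lra.
  rewrite ler_peMr//; have := expR_ge1Dx `|t|.
  by apply: le_trans; rewrite lerDl.
Qed.

(** Both sides of [0 <= expR t - 1 - t <= t * (expR t - 1)] come from
    [1 + t <= expR t], the second one applied to [- t]. *)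
Lemma expR_sub1D_le t : `|expR t - 1 - t| <= t ^+ 2 * expR `|t|.
Proof.
have h1 := expR_ge1Dx t.
have h2 : expR t - 1 <= t * expR t.
  have := ler_wpM2r (expR_ge0 t) (expR_ge1Dx (- t)).
  by rewrite expRN mulVf ?expR_eq0//; lra.
rewrite ger0_norm; last by lra.
apply: (@le_trans _ _ (t * (expR t - 1))); first by lra.
apply: (le_trans (ler_norm _)); rewrite normrM -real_normK ?num_real// expr2 -mulrA.
by rewrite ler_wpM2l// expR_sub1_le.
Qed.

Lemma sin_norm_le t : `|sin t| <= `|t|.
Proof.
wlog t0 : t / 0 <= t => [H|].
  by have [/H//|t0] := leP 0 t; rewrite -normrN -sinN -[leRHS]normrN H// oppr_ge0 ltW.
have [x _] := @MVT_segment R sin cos 0 t t0 (fun x _ => is_derive_sin x)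
  (continuous_subspaceT (@continuous_sin R)).
rewrite sin0 !subr0 => ->; rewrite normrM ler_piMl// cos_max//.
Qed.

Lemma cos_sub1_norm_le t : `|cos t - 1| <= t ^+ 2 / 2.
Proof.
have tE : t = (t / 2) *+ 2 by rewrite mulr2n -splitr.
have -> : cos t - 1 = - (sin (t / 2) ^+ 2 *+ 2).
  by rewrite {1}tE cos_mulr2n cos2sin2; ring.
rewrite normrN normrMn normrX.
have := lerXn2r 2 (normr_ge0 _) (normr_ge0 _) (sin_norm_le (t / 2)).
rewrite [X in _ <= X -> _]real_normK ?num_real//; lra.
Qed.

Lemma sin_sub_norm_le t : `|sin t - t| <= t ^+ 2.
Proof.
wlog t0 : t / 0 <= t => [H|].
  have [/H//|t0] := leP 0 t.
  have := H (- t); rewrite sinN sqrrN -opprD normrN; apply; lra.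
have der (x : R) : x \in `]0, t[ -> is_derive x 1 (fun y => sin y - y) (cos x - 1).
  by move=> _; apply: is_deriveB.
have ct : continuous (fun y : R => sin y - y).
  by move=> y; apply: cvgB; [exact: continuous_sin|exact: cvg_id].
have [x] := @MVT_segment R _ _ 0 t t0 der (continuous_subspaceT ct).
rewrite in_itv /= => /andP[x0 xt].
rewrite sin0 !subr0 => ->; rewrite normrM expr2 (ger0_norm t0) ler_wpM2r//.
have xE : x = (x / 2) *+ 2 by rewrite mulr2n -splitr.
have -> : cos x - 1 = - (sin (x / 2) ^+ 2 *+ 2).
  by rewrite {1}xE cos_mulr2n cos2sin2; ring.
rewrite normrN normrMn normrX expr2.
have h1 : `|sin (x / 2)| <= x / 2.
  by rewrite (le_trans (sin_norm_le _))// ger0_norm// divr_ge0.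
have := ler_wpM2l (normr_ge0 (sin (x / 2))) (sin_max (x / 2)).
by lra.
Qed.

(** Reduce to [0 <= s < 2 pi] by the floor; there [cos s = 1] forces
    [sin (s / 2) = 0], while sin is positive between 0 and pi. *)
Lemma cos_eq1 t : cos t = 1 -> exists m : int, t = 2 * pi * m%:~R.
Proof.
move=> ct; have p0 := pi_gt0 R.
pose m := Num.floor (t / (2 * pi)); exists m.
pose s := t - 2 * pi * m%:~R.
have percos (k : int) y : cos (y + 2 * pi * k%:~R) = cos y :> R.
  elim/int_ind: k y => [|n IH|n IH] y.
  - by rewrite mulr0 addr0.
  - have -> : y + 2 * pi * n.+1%:Z%:~R = (y + 2 * pi * n%:Z%:~R) + pi *+ 2.
      by rewrite (_ : n.+1%:Z = n%:Z + 1) ?intrD; [ring|lia].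
    by rewrite cosD2pi IH.
  - rewrite -[in RHS](IH y) -[LHS]cosD2pi; congr cos.
    by rewrite (_ : - n.+1%:Z = - n%:Z - 1) ?intrD ?intrN; [ring|lia].
have cs : cos s = 1.
  by rewrite /s -mulrN -intrN percos.
have s0 : 0 <= s.
  rewrite /s subr_ge0 -ler_pdivlMl ?mulr_gt0// mulrC.
  exact: floor_le.
have s1 : s < 2 * pi.
  rewrite /s ltrBlDl (_ : _ + _ = 2 * pi * (m + 1)%:~R); last by rewrite intrD; ring.
  rewrite -ltr_pdivrMl ?mulr_gt0//.
  by rewrite mulrC; have /andP[] := floor_itv (t / (2 * pi)).
apply/eqP; rewrite -subr_eq0 -/s; apply/eqP.
have sE : s = (s / 2) *+ 2 by rewrite mulr2n -splitr.
have s2 : sin (s / 2) = 0.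
  move: cs; rewrite {1}sE cos_mulr2n cos2sin2 => h.
  by apply/eqP; rewrite -sqrf_eq0; apply/eqP; lra.
have [//|sn0] := eqVneq s 0.
have : 0 < sin (s / 2).
  apply: sin_gt0_pi; have : 0 < s by rewrite lt_def sn0.
  by move=> ?; apply/andP; split; lra.
by rewrite s2 ltxx.
Qed.

End RealBounds.

(** * The complex exponential *)

Section ComplexExp.
Variable R : realType.
Local Notation C := (Cplx R).
Implicit Types z w : C.
Local Notation ipi := (ipi R : C).

Lemma Re_cexp z : complex.Re (cexp z) = expR (complex.Re z) * cos (complex.Im z).
Proof. by []. Qed.

Lemma Im_cexp z : complex.Im (cexp z) = expR (complex.Re z) * sin (complex.Im z).
Proof. by []. Qed.

Lemma cexpD z w : cexp (z + w) = cexp z * cexp w.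
Proof.
apply: complex_eqP.
- rewrite ReM !Re_cexp !Im_cexp ReD ImD expRD cosD; ring.
- rewrite ImM !Re_cexp !Im_cexp ReD ImD expRD sinD; ring.
Qed.

Lemma cexp0 : cexp 0 = 1 :> C.
Proof. by rewrite /cexp /= expR0 cos0 sin0 mulr1 mulr0. Qed.

Lemma norm_cexp z : `|cexp z| = (expR (complex.Re z))%:C.
Proof.
rewrite normc_def /= !exprMn -mulrDr cos2Dsin2 mulr1 sqrtr_sqr ger0_norm// expR_ge0.
Qed.

Lemma cexp_neq0 z : cexp z != 0.
Proof.
rewrite -normr_gt0 norm_cexp ltcR expR_gt0//.
Qed.

Lemma cexpN z : cexp (- z) = (cexp z)^-1.
Proof.
apply: (mulfI (cexp_neq0 z)).
by rewrite -cexpD subrr cexp0 mulfV// cexp_neq0.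
Qed.

Lemma cexpM_nat (n : nat) z : cexp (n%:R * z) = cexp z ^+ n.
Proof.
elim: n => [|n IH]; first by rewrite mul0r cexp0 expr0.
by rewrite -natr1 mulrDl mul1r cexpD IH exprSr.
Qed.

Lemma cexp_ipi : cexp ipi = -1.
Proof. by apply: complex_eqP; rewrite /= expR0 mul1r ?cospi ?sinpi ?oppr0. Qed.

Lemma cexp_2ipiM (m : int) : cexp (2 * ipi * m%:~R) = 1.
Proof.
have e1 : cexp (2 * ipi) = 1.
  by rewrite (_ : 2 * ipi = ipi + ipi) ?cexpD ?cexp_ipi; [ring|ring].
have e2 (n : nat) : cexp (2 * ipi * n%:R) = 1.
  by rewrite mulrC cexpM_nat e1 expr1n.
case: m => n; first exact: e2.
by rewrite NegzE intrN mulrN cexpN e2 invr1.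
Qed.

Lemma cexp_eq1 z : cexp z = 1 -> exists m : int, z = 2 * ipi * m%:~R.
Proof.
move=> z1.
have x0 : complex.Re z = 0.
  apply: (@expR_inj R); rewrite expR0; apply: complexI.
  by rewrite -norm_cexp z1 normr1.
have [m mE] : exists m : int, complex.Im z = 2 * pi * m%:~R.
  by apply: cos_eq1; have := congr1 (@complex.Re R) z1; rewrite Re_cexp x0 expR0 mul1r.
exists m.
have -> : m%:~R = (m%:~R : R)%:C :> C by rewrite rmorph_int.
by apply: complex_eqP; rewrite ?ReM ?ImM /= ?x0 ?mE; ring.
Qed.

(** This bound is used both for the exponential itself and, termwise, for theta:
    it is uniform enough in [w] to be summed against Gaussian weights. *)
Lemma cexp_sub1D_le w (r : R) : `|w| <= r%:C ->
  `|cexp w - 1 - w| <= 3 * `|w| ^+ 2 * (expR r)%:C.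
Proof.
move=> wr; set x := complex.Re w; set y := complex.Im w.
have xr : `|x| <= r := norm_Re_le wr.
have er : expR `|x| <= expR r by rewrite ler_expR.
have e0 := expR_ge0 r; have e1 : 1 <= expR r.
  by rewrite -expR0 ler_expR (le_trans _ xr).
rewrite -add_Re2_Im2 -/x -/y.
apply: (le_trans (norm_le_ReIm _)).
have -> : 3 = (3 : R)%:C :> C by rewrite rmorphMn.
rewrite -!rmorphM lecR.
have exr : expR x <= expR r by rewrite ler_expR (le_trans (ler_norm _)).
have re : `|complex.Re (cexp w - 1 - w)| <= (x ^+ 2 + y ^+ 2) * expR r.
  have -> : complex.Re (cexp w - 1 - w) = expR x * (cos y - 1) + (expR x - 1 - x).
    by rewrite !ReD !ReN Re_cexp /= -/x -/y; ring.
  apply: (le_trans (ler_normD _ _)); rewrite mulrDl [leRHS]addrC.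
  apply: lerD.
    rewrite normrM mulrC (@ger0_norm _ (expR x)) ?expR_ge0//; apply: ler_pM => //.
    by apply: (le_trans (cos_sub1_norm_le y)); have := sqr_ge0 y; lra.
  by apply: (le_trans (expR_sub1D_le x)); rewrite ler_wpM2l// sqr_ge0.
have im : `|complex.Im (cexp w - 1 - w)| <= (y ^+ 2 + `|y| * `|x|) * expR r.
  have -> : complex.Im (cexp w - 1 - w) = expR x * (sin y - y) + y * (expR x - 1).
    by rewrite !ImD !ImN Im_cexp /= -/x -/y; ring.
  apply: (le_trans (ler_normD _ _)); rewrite mulrDl.
  apply: lerD.
    rewrite normrM mulrC (@ger0_norm _ (expR x)) ?expR_ge0//; apply: ler_pM => //.
    exact: sin_sub_norm_le.
  rewrite normrM -mulrA ler_wpM2l//.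
  by apply: (le_trans (expR_sub1_le x)); rewrite ler_wpM2l.
apply: (le_trans (lerD re im)); rewrite -mulrDl ler_wpM2r//.
have := sqr_ge0 (`|x| - `|y|); rewrite sqrrB !real_normK ?num_real// -mulr_natr.
have := sqr_ge0 x; have := sqr_ge0 y; rewrite (mulrC `|y|); lra.
Qed.

Lemma derivable_of_taylor (f : C -> C) z (D K : C) :
  (forall h : C, `|h| <= 1 -> `|f (z + h) - f z - h * D| <= K * `|h| ^+ 2) ->
  derivable f z 1.
Proof.
move=> HK.
have K0 : 0 <= K.
  by have := HK 1; rewrite normr1 expr1n mulr1 lexx => /(_ isT); exact: le_trans.
apply/cvg_ex; exists D; apply/cvgrPdist_le => e e0.
have K1 : 0 < K + 1 by rewrite ltr_wpDl.
near=> h.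
have h0 : h != 0 by near: h; exact: nbhs_dnbhs_neq.
have h1 : `|h| <= 1 by near: h; apply: dnbhs0_le.
have h2 : `|h| <= e / (K + 1) by near: h; apply: dnbhs0_le; rewrite divr_gt0.
set q := h^-1 *: _.
have E : h * (D - q) = - (f (z + h) - f z - h * D).
  have -> : q = h^-1 * (f (h * 1 + z) - f z) by [].
  by rewrite mulr1 (addrC h) mulrBr mulrA mulfV// mul1r; ring.
rewrite -(ler_pM2l (_ : 0 < `|h|)) ?normr_gt0// -normrM E normrN.
apply: (le_trans (HK h h1)); rewrite expr2 mulrCA ler_wpM2l//.
have KK : K <= K + 1 by rewrite lerDl.
apply: (le_trans (ler_wpM2r (normr_ge0 h) KK)).
by rewrite mulrC -ler_pdivlMr.
Unshelve. all: by end_near. Qed.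

Lemma cexp_derivable z : derivable (@cexp R : C -> C) z 1.
Proof.
apply: (@derivable_of_taylor _ _ (cexp z) (`|cexp z| * (3 * (expR 1)%:C))) => h h1.
rewrite cexpD (_ : _ - _ - _ = cexp z * (cexp h - 1 - h)); last by ring.
rewrite normrM -mulrA ler_wpM2l//.
have h1' : `|h| <= (1 : R)%:C by rewrite rmorph1.
by have := cexp_sub1D_le h1'; rewrite mulrAC.
Qed.

End ComplexExp.

(** * Theta: parity, addition formula, differentiability *)

Section ThetaSeries.
Variable R : realType.
Local Notation C := (Cplx R).
Implicit Types x y z tau : C.
Local Notation ipi := (ipi R : C).

Lemma Re_intM (x : C) (j : int) : complex.Re (x * j%:~R) = complex.Re x * j%:~R.
Proof.
have -> : j%:~R = (j%:~R : R)%:C :> C by rewrite rmorph_int.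
by rewrite ReM /= mulr0 subr0.
Qed.

Lemma absz_int_norm (j : int) : `|j%:~R : C| = (`|j|%N%:R : R)%:C.
Proof. by rewrite -intr_norm -abszE rmorph_nat. Qed.

Lemma exp_decay (n : nat) : expR (- n%:R) <= (2^-1 : R) ^+ n.
Proof.
rewrite -[n%:R]mulr1 -mulrN expRM_natl; apply: lerXn2r; rewrite ?nnegrE ?expR_ge0 ?invr_ge0//.
rewrite expRN lef_pV2 ?posrE ?expR_gt0//; have := expR_ge1Dx (1 : R); lra.
Qed.

Lemma decay_exp_ge1 (j : int) : 1 <= decay R j * (expR (`|j|%N%:R))%:C.
Proof.
have := exp_decay `|j|%N; rewrite expRN -(ler_pM2r (expR_gt0 (`|j|%N%:R))).
rewrite mulVf ?expR_eq0// -lecR rmorphM rmorphXn fmorphV rmorphMn; exact.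
Qed.

(** Completing the square bounds a Gaussian term by a multiple of [decay], even
    after multiplication by an arbitrary exponential in [|j|]. *)
Lemma gauss_bound (A B D : C) (r : R) : complex.Re A < 0 -> exists K : C, forall j : int,
  `|cexp (A * j%:~R ^+ 2 + B * j%:~R + D)| * (expR (r * `|j|%N%:R))%:C
    <= K * decay R j.
Proof.
move=> A0; set a := - complex.Re A; pose b := `|complex.Re B| + r + 1.
pose M := b ^+ 2 / (4 * a) + complex.Re D.
have a0 : 0 < a by rewrite oppr_gt0.
exists (expR M)%:C => j; set n := `|j|%N.
rewrite norm_cexp -rmorphM -expRD.
have -> : decay R j = ((2^-1 : R) ^+ n)%:C by rewrite rmorphXn fmorphV rmorphMn.
rewrite -rmorphM lecR.
apply: le_trans (ler_wpM2l (expR_ge0 M) (exp_decay n)).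
rewrite -expRD ler_expR !ReD Re_intM -rmorphXn Re_intM rmorphXn /=.
have jn : (j%:~R : R) ^+ 2 = n%:R ^+ 2.
  by rewrite -[LHS]real_normK ?num_real// -intr_norm -abszE.
have Bn : complex.Re B * j%:~R <= `|complex.Re B| * n%:R.
  by apply: (le_trans (ler_norm _)); rewrite normrM -intr_norm -abszE.
rewrite jn (_ : complex.Re A = - a); last by rewrite opprK.
suff : b * n%:R - a * n%:R ^+ 2 <= b ^+ 2 / (4 * a).
  by rewrite /M /b; lra.
rewrite -subr_ge0 (_ : _ - _ = (b - 2 * a * n%:R) ^+ 2 / (4 * a)).
  by rewrite divr_ge0 ?sqr_ge0 ?mulr_ge0// ltW.
by field; rewrite gt_eqF.
Qed.

Lemma gauss_bounded (A B D : C) : complex.Re A < 0 ->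
  exists K : C, bounded_by K (fun j => cexp (A * j%:~R ^+ 2 + B * j%:~R + D)).
Proof.
move=> A0; have [K HK] := gauss_bound B D 0 A0; exists K => j.
by have := HK j; rewrite mul0r expR0 mulr1.
Qed.

Definition theta_term tau z (j : int) : C :=
  cexp (ipi * (j%:~R + 2^-1) ^+ 2 * tau + 2 * ipi * (j%:~R + 2^-1) * (z + 2^-1)).

Lemma theta_termE tau z j : theta_term tau z j =
  cexp (ipi * tau * j%:~R ^+ 2 + (ipi * tau + 2 * ipi * (z + 2^-1)) * j%:~R
        + (ipi * tau / 4 + ipi * (z + 2^-1))).
Proof. by congr cexp; field. Qed.

Lemma thetaE tau z : theta tau z = - sum_int (theta_term tau z).
Proof. by []. Qed.

Section FixedTau.
Variable tau : C.
Hypothesis tau_gt0 : 0 < complex.Im tau.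

Lemma Re_ipi_tau (c : R) : 0 < c -> complex.Re (c%:C * (ipi * tau)) < 0.
Proof.
move=> c0; rewrite !ReM !ImM /= !mul0r !(mulr0, mul0r, addr0, subr0, sub0r, add0r).
by rewrite mulrN oppr_lt0 !mulr_gt0// pi_gt0.
Qed.

Lemma theta_term_bound z (r : R) : exists K : C, forall j : int,
  `|theta_term tau z j| * (expR (r * `|j|%N%:R))%:C <= K * decay R j.
Proof.
have A0 := Re_ipi_tau ltr01; rewrite mul1r in A0.
have [K HK] := gauss_bound (ipi * tau + 2 * ipi * (z + 2^-1))
  (ipi * tau / 4 + ipi * (z + 2^-1)) r A0.
by exists K => j; rewrite theta_termE.
Qed.

Lemma theta_term_bounded z : exists K : C, bounded_by K (theta_term tau z).
Proof.
have [K HK] := theta_term_bound z 0; exists K => j.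
by have := HK j; rewrite mul0r expR0 mulr1.
Qed.

Lemma theta_term_decay2 z : exists K : C, forall j,
  `|theta_term tau z j| <= K * (decay R j * decay R j).
Proof.
have [K HK] := theta_term_bound z 1; exists K => j.
apply: (le_trans (ler_peMr (normr_ge0 _) (decay_exp_ge1 j))).
have := ler_wpM2r (decay_ge0 R j) (HK j); rewrite mul1r.
by rewrite -mulrA [X in _ * X]mulrC -[leRHS]mulrA.
Qed.

Lemma cexp_ipi_odd (j : int) : cexp (2 * ipi * (j%:~R + 2^-1)) = -1.
Proof.
rewrite mulrDr cexpD cexp_2ipiM mul1r -cexp_ipi; congr cexp; by field.
Qed.

(** The reflection [j -> - 1 - j] changes the sign of [j + 1/2]; what remains is
    the factor [cexp (2 * ipi * (j + 1/2)) = - 1]. *)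
Lemma theta_odd z : theta tau (- z) = - theta tau z.
Proof.
rewrite !thetaE; congr (- _); have [K zK] := theta_term_bounded z.
rewrite -[RHS]mulN1r -(sum_intZ (-1) zK).
rewrite -[LHS]sum_int_reflect; apply: eq_sum_int => j.
rewrite -(cexp_ipi_odd (- j - 1)) -cexpD; congr cexp.
by rewrite intrB intrN; field.
Qed.

Lemma theta0 : theta tau 0 = 0.
Proof.
have := theta_odd 0; rewrite oppr0 => /eqP; rewrite -subr_eq0 opprK -mulr2n mulrn_eq0 /=.
by move/eqP.
Qed.

(** The two theta functions of characteristic [0] and [1/2] for [2 tau], as
    functions of [2 x]: a basis of the even theta functions of order two. *)
Definition theta_even x : C :=
  sum_int (fun t => cexp (2 * (ipi * tau) * t%:~R ^+ 2 + 4 * ipi * t%:~R * x)).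

Definition theta_half x : C :=
  sum_int (fun t => cexp (2 * (ipi * tau) * (t%:~R + 2^-1) ^+ 2
                          + 4 * ipi * (t%:~R + 2^-1) * x)).

Lemma two_ipi_tau : complex.Re (2 * (ipi * tau)) < 0.
Proof.
have -> : 2 = (2 : R)%:C :> C by rewrite rmorphMn.
exact: Re_ipi_tau.
Qed.

Lemma theta_even_bounded x : exists K : C, bounded_by K (fun t =>
  cexp (2 * (ipi * tau) * t%:~R ^+ 2 + 4 * ipi * t%:~R * x)).
Proof.
have [K HK] := gauss_bounded (4 * ipi * x) 0 two_ipi_tau; exists K => j.
by have := HK j; rewrite addr0 (mulrAC _ x).
Qed.

Lemma theta_half_bounded x : exists K : C, bounded_by K (fun t =>
  cexp (2 * (ipi * tau) * (t%:~R + 2^-1) ^+ 2 + 4 * ipi * (t%:~R + 2^-1) * x)).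
Proof.
have [K HK] := gauss_bounded (2 * (ipi * tau) + 4 * ipi * x)
  (2 * (ipi * tau) / 4 + 2 * ipi * x) two_ipi_tau; exists K => j.
have := HK j; congr (_ <= _); congr (`| cexp _ |); by field.
Qed.

Lemma sum_int_prod K K' (f g : int -> C) : bounded_by K f -> bounded_by K' g ->
  sum_int (fun t => sum_int (fun e => f t * g e)) = sum_int f * sum_int g.
Proof.
move=> fK gK; rewrite mulrC -(sum_intZ _ fK); apply: eq_sum_int => t.
by rewrite (sum_intZ _ gK) mulrC.
Qed.

(** Multiply the two series and sum over [j + k] and [j - k]: these integers have
    the same parity, and each parity class contributes a product of two series. *)
Lemma theta_mul_addsub x y : theta tau (x + y) * theta tau (x - y) =
  theta_even x * theta_half y - theta_half x * theta_even y.
Proof.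
have [K1 a1] := theta_term_decay2 (x + y); have [K2 a2] := theta_term_decay2 (x - y).
have [K3 b1] := theta_term_bounded (x + y); have [K4 b2] := theta_term_bounded (x - y).
pose F j k := theta_term tau (x + y) j * theta_term tau (x - y) k.
have d1 j : decay R j <= 1 by rewrite exprn_ile1// ?invr_ge0// invf_le1// ler1n.
have K10 : 0 <= K1.
  by have := a1 0; rewrite /decay /= expr0 !mulr1; exact: le_trans.
have K20 : 0 <= K2.
  by have := a2 0; rewrite /decay /= expr0 !mulr1; exact: le_trans.
have FK j k : `|F j (k - j)| <= K1 * K2 * decay R j * decay R k.
  rewrite normrM; apply: (le_trans (ler_pM _ _ (a1 j) (a2 (k - j)))) => //.
  rewrite [leLHS](_ : _ = K1 * K2 * decay R j *
    (decay R j * decay R (k - j) * decay R (k - j))); last by ring.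
  apply: ler_wpM2l; first by rewrite !mulr_ge0// decay_ge0.
  apply: (@le_trans _ _ (decay R j * decay R (k - j))).
    by rewrite ler_piMr// mulr_ge0// decay_ge0.
  by apply: (le_trans (decay_mul_le _ _ _)); rewrite addrC subrK.
have rowK j : bounded_by (K1 * K2 * decay R j) (fun k => F j (k - j)) by move=> k.
have K120 : 0 <= K1 * K2 by rewrite mulr_ge0.
have FeK j t : `|F j (2 * t - j)| <= K1 * K2 * decay R j * decay R t.
  apply: (le_trans (FK _ _)); rewrite ler_wpM2l ?mulr_ge0 ?decay_ge0//.
  by apply: decay_le; lia.
have FoK j t : `|F j (2 * t + 1 - j)| <= K1 * K2 * decay R j * decay R t.
  apply: (le_trans (FK _ _)); rewrite ler_wpM2l ?mulr_ge0 ?decay_ge0//.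
  by apply: decay_le; lia.
have colK (G : int -> int -> C) :
    (forall j t, `|G j t| <= K1 * K2 * decay R j * decay R t) ->
    bounded_by (4 * (K1 * K2)) (fun j => sum_int (G j)).
  move=> GK j; rewrite -mulrA; apply: sum_int_bound => t; exact: GK.
rewrite !thetaE mulrNN -(sum_int_prod b1 b2) -/F.
(* Shifting k by - j makes the inner index the sum of the two; it is then split by
   parity, and after the exchange of sums j is recentred at half of it. *)
transitivity (sum_int (fun j => sum_int (fun t => F j (2 * t - j))
    + sum_int (fun t => F j (2 * t + 1 - j)))).
  apply: eq_sum_int => j.
  rewrite -(sum_int_parity (rowK j)).
  have bj : bounded_by (`|theta_term tau (x + y) j| * K4) (F j) by exact: boundedZ.
  by rewrite -(sum_int_shift (- j) bj).
rewrite (sum_intD (colK _ FeK) (colK _ FoK)).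
rewrite (sum_int_exchange FeK) (sum_int_exchange FoK) addrC.
have [Kex ex] := theta_even_bounded x; have [Khx hx] := theta_half_bounded x.
have [Key ey] := theta_even_bounded y; have [Khy hy] := theta_half_bounded y.
have colB (G : int -> int -> C) t :
    (forall j t, `|G j t| <= K1 * K2 * decay R j * decay R t) ->
    bounded_by (K1 * K2 * decay R t) (fun j => G j t).
  by move=> GK j; rewrite mulrAC; exact: GK.
congr (_ + _).
- rewrite -(sum_int_prod ex hy).
  transitivity (sum_int (fun t => theta_half y * cexp (2 * (ipi * tau)
      * (t + 1)%:~R ^+ 2 + 4 * ipi * (t + 1)%:~R * x))).
    apply: eq_sum_int => t; rewrite -(sum_int_shift (t + 1) (colB _ t FoK)).
    rewrite [RHS]mulrC -(sum_intZ _ hy); apply: eq_sum_int => e.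
    rewrite (_ : 2 * t + 1 - (e + (t + 1)) = t - e); last lia.
    rewrite -[RHS]mulr1 -[X in _ = _ * X](cexp_2ipiM R (t + 1)) /F /theta_term -!cexpD.
    by congr cexp; rewrite !(intrD, intrN); field.
  rewrite (sum_int_shift1 (boundedZ (theta_half y) ex)); apply: eq_sum_int => t.
  by rewrite (sum_intZ _ hy) mulrC.
- rewrite -(sum_int_prod hx ey) -[RHS]mulN1r.
  transitivity (sum_int (fun t => -1 * (theta_even y * cexp (2 * (ipi * tau)
      * (t%:~R + 2^-1) ^+ 2 + 4 * ipi * (t%:~R + 2^-1) * x)))).
    apply: eq_sum_int => t; rewrite -(sum_int_shift t (colB _ t FeK)).
    rewrite (mulrC (theta_even y)) [RHS]mulrA -(sum_intZ _ ey); apply: eq_sum_int => e.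
    rewrite (_ : 2 * t - (e + t) = t - e); last lia.
    rewrite -(cexp_ipi_odd t) /F /theta_term -!cexpD.
    by congr cexp; rewrite intrD intrB; field.
  rewrite (sum_intZ _ (boundedZ (theta_even y) hx)); congr (_ * _).
  by apply: eq_sum_int => t; rewrite (sum_intZ _ ey) mulrC.
Qed.

(** By [theta_mul_addsub] each product of two theta values is a minor [D] of a two
    by four matrix, once the arguments are centred at [s]; the relation is then the
    Pluecker relation between these minors. *)
Lemma theta_three_term a1 a2 b1 b2 t :
  theta tau (a1 - a2) * theta tau (b1 + b2 - a1 - a2) *
    (theta tau (t - b1) * theta tau (t - b2)) =
  theta tau (b1 - a2) * theta tau (b2 - a2) *
    (theta tau (t - a1) * theta tau (t - (b1 + b2 - a1)))
  - theta tau (b1 - a1) * theta tau (b2 - a1) *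
    (theta tau (t - a2) * theta tau (t - (b1 + b2 - a2))).
Proof.
pose s := (b1 + b2) / 2.
pose D u v := theta_even u * theta_half v - theta_half u * theta_even v.
have E x y u v : u = x + y -> v = x - y -> theta tau u * theta tau v = D x y.
  by move=> -> ->; exact: theta_mul_addsub.
have E' x y u v : u = - (x + y) -> v = x - y -> theta tau v * theta tau u = - D x y.
  by move=> -> ->; rewrite theta_odd mulrN mulrC (E x y).
rewrite (E' (a1 - s) (a2 - s) (b1 + b2 - a1 - a2) (a1 - a2)); [|by rewrite /s; field..].
rewrite (E' (b1 - s) (a2 - s) (b2 - a2) (b1 - a2)); [|by rewrite /s; field..].
rewrite (E' (b1 - s) (a1 - s) (b2 - a1) (b1 - a1)); [|by rewrite /s; field..].
have F v v' : v' = b1 + b2 - v ->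
    theta tau (t - v) * theta tau (t - v') = D (t - s) (v - s).
  by move=> ->; rewrite mulrC; apply: E; rewrite /s; field.
rewrite (F b1 b2) ?(F a1) ?(F a2)//; last by ring.
rewrite /D; ring.
Qed.

Lemma norm_ipi : `|ipi| = (pi : R)%:C.
Proof. by rewrite normc_def /= expr0n add0r sqrtr_sqr ger0_norm// pi_ge0. Qed.

Lemma half_addn1_le (j : int) : `|j%:~R + 2^-1 : C| <= (`|j|%N.+1%:R : R)%:C.
Proof.
apply: (le_trans (ler_normD _ _)); 
rewrite absz_int_norm -(natr1 `|j|%N) [leRHS]rmorphD /= rmorph1 rmorph_nat lerD2l.
by rewrite ger0_norm ?invr_ge0// invf_le1 ?ler1n.
Qed.

(** Termwise differentiation.  By [cexp_sub1D_le] the remainder of the term [j] is at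
    most its norm times [3 * `|h| ^+ 2 * r j ^+ 2 * expR (r j)], hence at most
    [6 * `|h| ^+ 2 * expR (2 * r j)] times its norm: this is where the rate
    [4 * pi] comes from. *)
Lemma theta_taylor z : exists D K : C, forall h : C, `|h| <= 1 ->
  `|theta tau (z + h) - theta tau z - h * D| <= K * `|h| ^+ 2.
Proof.
have p0 := pi_gt0 R.
have [K HK] := theta_term_bound z (4 * pi).
have [K0 HK0] := theta_term_bounded z.
pose d j : C := 2 * ipi * (j%:~R + 2^-1).
pose r j : R := 2 * pi * `|j|%N.+1%:R.
have dr j : `|d j| <= (r j)%:C.
  rewrite /d /r rmorphM normrM ler_pM//; last exact: half_addn1_le.
  by rewrite normrM norm_ipi rmorphM rmorph_nat ger0_norm.
have r0 j : 0 <= r j by rewrite /r !mulr_ge0// ltW.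
have re j : r j <= expR (r j) by have := expR_ge1Dx (r j); lra.
have r2e j : r j ^+ 2 <= 2 * expR (r j).
  have := expR_ge1Dxn 1 (r0 j); rewrite (_ : 2`! = 2)%N//; lra.
have erj j : expR (r j) * expR (r j) = expR (4 * pi) * expR (4 * pi * `|j|%N%:R).
  by rewrite -!expRD /r -natr1; congr expR; ring.
pose L := (6 * expR (4 * pi))%:C * K.
have dK : bounded_by ((expR (4 * pi))%:C * K) (fun j => theta_term tau z j * d j).
  move=> j; rewrite normrM -mulrA.
  apply: le_trans (ler_wpM2l _ (HK j)); last by rewrite lecR expR_ge0.
  rewrite mulrCA ler_wpM2l// -rmorphM -erj (le_trans (dr j))// lecR.
  apply: (le_trans (re j)); rewrite ler_peMr ?expR_ge0//.
  by rewrite -expR0 ler_expR.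
exists (- sum_int (fun j => theta_term tau z j * d j)), (4 * L) => h h1.
have rem j : theta_term tau (z + h) j - theta_term tau z j
    - h * (theta_term tau z j * d j)
    = theta_term tau z j * (cexp (h * d j) - 1 - h * d j).
  have -> : theta_term tau (z + h) j = theta_term tau z j * cexp (h * d j).
    by rewrite -cexpD; congr cexp; rewrite /d; ring.
  by ring.
have remL : bounded_by (L * `|h| ^+ 2) (fun j => theta_term tau (z + h) j
    - theta_term tau z j - h * (theta_term tau z j * d j)).
  move=> j; rewrite rem normrM.
  have hd : `|h * d j| <= (r j)%:C.
    by rewrite normrM (le_trans _ (dr j))// ler_piMl.
  have := cexp_sub1D_le hd => /(ler_wpM2l (normr_ge0 (theta_term tau z j))) /le_trans; apply.
  apply: (@le_trans _ _ ((6 * expR (4 * pi))%:C * `|h| ^+ 2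
      * (`|theta_term tau z j| * (expR (4 * pi * `|j|%N%:R))%:C))); last first.
    rewrite (_ : L * _ * _ = (6 * expR (4 * pi))%:C * `|h| ^+ 2 * (K * decay R j)).
      by apply: ler_wpM2l (HK j); rewrite mulr_ge0 ?exprn_ge0// lecR mulr_ge0 ?expR_ge0.
    by rewrite /L; ring.
  rewrite [leRHS]mulrCA ler_wpM2l//.
  have d2 : `|d j| ^+ 2 <= (2 * expR (r j))%:C.
    apply: (@le_trans _ _ ((r j)%:C ^+ 2)); first by rewrite !expr2 ler_pM.
    by rewrite -rmorphXn lecR.
  have re0 : 0 <= (expR (r j))%:C :> C by rewrite lecR expR_ge0.
  have d3 : `|d j| ^+ 2 * (expR (r j))%:C <=
      (2 * (expR (4 * pi) * expR (4 * pi * `|j|%N%:R)))%:C.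
    by rewrite -erj mulrA rmorphM ler_wpM2r.
  rewrite normrM exprMn (_ : 3 * _ * _ =
    3 * `|h| ^+ 2 * (`|d j| ^+ 2 * (expR (r j))%:C)); last by ring.
  rewrite (_ : (6 * _)%:C * _ * _ = 3 * `|h| ^+ 2 *
    (2 * (expR (4 * pi) * expR (4 * pi * `|j|%N%:R)))%:C).
    by apply: ler_wpM2l d3; rewrite mulr_ge0// exprn_ge0.
  by rewrite !rmorphM !rmorph_nat /=; ring.
have [K1 HK1] := theta_term_bounded (z + h).
have -> : theta tau (z + h) - theta tau z - h * - sum_int (fun j => theta_term tau z j * d j)
   = - sum_int (fun j => theta_term tau (z + h) j
    - theta_term tau z j - h * (theta_term tau z j * d j)).
  have nK := boundedZ (-1) HK0; have hK := boundedZ (- h) dK.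
  rewrite [X in _ = - sum_int X](_ : _ = (fun j => (theta_term tau (z + h) j
    + -1 * theta_term tau z j) + - h * (theta_term tau z j * d j))).
    rewrite (sum_intD (boundedD HK1 nK) hK) (sum_intD HK1 nK) (sum_intZ _ HK0) (sum_intZ _ dK).
    have opp (u v e : C) : - u - - v - h * - e = - (u + -1 * v + - h * e) by ring.
    exact: opp.
  by apply/funext => j; ring.
by rewrite normrN -mulrA; exact: sum_int_bound.
Qed.

Lemma theta_derivable z : derivable (theta tau : C -> C) z 1.
Proof.
by have [D [K HK]] := theta_taylor z; exact: derivable_of_taylor HK.
Qed.

End FixedTau.

End ThetaSeries.

(** * The q-binomial theorem *)

Section QBinomial.
Variables (F : fieldType) (q : F).
Hypothesis q_nroot : forall k : nat, 1 - q ^+ k.+1 != 0.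

Definition qfact (n : nat) : F := \prod_(k < n) (1 - q ^+ k.+1).

Lemma qfactS n : qfact n.+1 = qfact n * (1 - q ^+ n.+1).
Proof. by rewrite /qfact big_ord_recr. Qed.

Lemma qfact_neq0 n : qfact n != 0.
Proof. by apply/prodf_neq0 => k _; exact: q_nroot. Qed.

Definition qbin (m i : nat) : F := qfact m / (qfact i * qfact (m - i)).

Lemma qfact0 : qfact 0 = 1.
Proof. by rewrite /qfact big_ord0. Qed.

Lemma qbin0 m : qbin m 0 = 1.
Proof. by rewrite /qbin subn0 qfact0 mul1r divff// qfact_neq0. Qed.

Lemma qbinn m : qbin m m = 1.
Proof. by rewrite /qbin subnn qfact0 mulr1 divff// qfact_neq0. Qed.

Lemma qbin_pascal m i : (i < m)%N ->
  qbin m.+1 i.+1 = qbin m i.+1 + q ^+ (m - i) * qbin m i.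
Proof.
move=> im; pose k := (m - i.+1)%N.
have mE : m = (i + k).+1 by rewrite /k; lia.
rewrite /qbin (_ : m.+1 - i.+1 = k.+1)%N; last lia.
rewrite (_ : m - i.+1 = k)%N// (_ : m - i = k.+1)%N; last lia.
rewrite !qfactS mE (_ : (i + k).+2 = i.+1 + k.+1)%N; last lia.
rewrite exprD; field.
by rewrite !q_nroot !qfact_neq0.
Qed.

Lemma q_binomial (x : F) (m : nat) :
  \prod_(k < m) (1 + x * q ^+ k) =
  \sum_(i < m.+1) qbin m i * q ^+ 'C(i, 2) * x ^+ i.
Proof.
elim: m => [|m IH].
  by rewrite big_ord0 big_ord_recl big_ord0 qbin0 bin0n !expr0 !mulr1 addr0.
rewrite big_ord_recr /= IH mulrDr mulr1.
rewrite [RHS]big_ord_recl [in RHS]big_ord_recr.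
rewrite [X in X + _ = _]big_ord_recl [X in _ + X * _ = _]big_ord_recr /=.
rewrite !qbin0 !qbinn -!addrA; congr (_ + _).
rewrite mulrDl big_distrl /= addrA -big_split /=; congr (_ + _).
  apply: eq_bigr => i _; rewrite /bump /= !add1n qbin_pascal//.
  have -> : q ^+ m = q ^+ (m - i) * q ^+ i by rewrite -exprD subnK// ltnW.
  by rewrite binS bin1 !exprD exprS; ring.
by rewrite /bump /= add1n binS bin1 exprD exprS; ring.
Qed.

End QBinomial.

(** * Products with geometrically small factors *)

Section GeometricProducts.
Variable R : realType.
Local Notation C := (Cplx R).
Variables (u : nat -> C) (K r : R).
Hypotheses (r0 : 0 <= r) (r1 : r < 1) (uK : forall k, `|u k| <= (K * r ^+ k)%:C).

Let gprod n : C := \prod_(k < n) (1 - u k).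

Lemma geo_const_ge0 : 0 <= K.
Proof.
have := uK 0; rewrite expr0 mulr1 => h.
by have := le_trans (normr_ge0 _) h; rewrite lecR.
Qed.

Lemma sum_geo_le (n : nat) : \sum_(k < n) r ^+ k <= (1 - r)^-1.
Proof.
have r1' : 0 < 1 - r by rewrite subr_gt0.
suff -> : \sum_(k < n) r ^+ k = (1 - r ^+ n) / (1 - r).
  by rewrite ler_pdivrMr// mulVf ?gt_eqF// lerBlDr lerDl exprn_ge0.
elim: n => [|n IH]; first by rewrite big_ord0 expr0 subrr mul0r.
by rewrite big_ord_recr /= IH exprS; field; rewrite gt_eqF.
Qed.

Lemma norm_prod_segment_le (m n : nat) :
  `|\prod_(k < n) (1 - u (m + k))| <= (expR (K / (1 - r)))%:C.
Proof.
have K0 := geo_const_ge0.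
suff h : `|\prod_(k < n) (1 - u (m + k))| <= (expR (K * \sum_(k < n) r ^+ k))%:C.
  by apply: (le_trans h); rewrite lecR ler_expR ler_wpM2l// sum_geo_le.
elim: n => [|n IH]; first by rewrite !big_ord0 mulr0 expR0 normr1.
rewrite !big_ord_recr /= (mulrDr K) expRD normrM rmorphM ler_pM//.
apply: (le_trans (ler_normB _ _)); rewrite normr1.
apply: (le_trans (lerD (lexx _) (uK _))).
rewrite -[X in X + _](rmorph1 (real_complex R)) -rmorphD lecR.
apply: le_trans (expR_ge1Dx _); rewrite lerD2l ler_wpM2l// exprD ler_piMl ?exprn_ge0//.
by rewrite exprn_ile1// ltW.
Qed.

Lemma norm_gprod_le n : `|gprod n| <= (expR (K / (1 - r)))%:C.
Proof. exact: (norm_prod_segment_le 0). Qed.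

Lemma gprod_split m n : gprod (m + n) = gprod m * \prod_(k < n) (1 - u (m + k)).
Proof. by rewrite /gprod big_split_ord. Qed.

(** By Weierstrass' inequality the product of the factors beyond some index [L] is
    at least 1/2.  For [n < L], compare with the product up to [L] instead: the
    factors in between are bounded by [norm_prod_segment_le]. *)
Lemma norm_gprod_ge : (forall k, u k != 1) ->
  exists2 d : R, 0 < d & forall n, d%:C <= `|gprod n|.
Proof.
move=> u1; have K0 := geo_const_ge0; have r1' : 0 < 1 - r by rewrite subr_gt0.
have g0 n : gprod n != 0.
  by apply/prodf_neq0 => k _; rewrite subr_eq0 eq_sym u1.
have [L KL] : exists L, K * r ^+ L / (1 - r) <= 2^-1.
  have h : (fun n => K * r ^+ n / (1 - r)) @ \oo --> K * 0 / (1 - r).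
    apply: cvgM; last exact: cvg_cst.
    by apply: cvgM; [exact: cvg_cst|apply: cvg_expr; rewrite ger0_norm].
  rewrite mulr0 mul0r in h.
  have e0 : 0 < (2^-1 : R) by rewrite invr_gt0.
  have /cvgrPdist_le/(_ _ e0)[L _ /(_ L (leqnn L))] := h.
  rewrite /= sub0r normrN => h'; exists L; exact: le_trans (ler_norm _) h'.
have tail n : (2^-1 : R)%:C <= `|\prod_(k < n) (1 - u (L + k))|.
  suff h : (1 - K * r ^+ L * \sum_(k < n) r ^+ k)%:C <= `|\prod_(k < n) (1 - u (L + k))|.
    apply: le_trans h; rewrite lecR.
    have := ler_wpM2l (mulr_ge0 K0 (exprn_ge0 L r0)) (sum_geo_le n); lra.
  elim: n => [|n IH]; first by rewrite !big_ord0 mulr0 subr0 normr1.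
  set s := \sum_(k < n) _ in IH; set p := \prod_(k < n) _ in IH.
  rewrite !big_ord_recr /= -/s -/p.
  have s0 : 0 <= s by rewrite sumr_ge0// => k _; rewrite exprn_ge0.
  have un : `|u (L + n)%N| <= (K * r ^+ L * r ^+ n)%:C by rewrite -mulrA -exprD.
  set t := K * r ^+ L in IH un *; have t0 : 0 <= t by rewrite mulr_ge0 ?exprn_ge0.
  have rn0 : 0 <= r ^+ n by rewrite exprn_ge0.
  have [ts|ts] := leP (1 - t * s) 0.
    apply: (@le_trans _ _ 0) => //; rewrite -(rmorph0 (real_complex R)) lecR.
    have := mulr_ge0 t0 rn0; lra.
  have [tr|tr] := leP (1 - t * r ^+ n) 0.
    apply: (@le_trans _ _ 0) => //; rewrite -(rmorph0 (real_complex R)) lecR.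
    have := mulr_ge0 t0 s0; lra.
  apply: (@le_trans _ _ (((1 - t * s) * (1 - t * r ^+ n))%:C)).
    rewrite lecR; have := mulr_ge0 (mulr_ge0 t0 s0) (mulr_ge0 t0 rn0); lra.
  rewrite normrM rmorphM; apply: ler_pM => //; try by rewrite lecR ltW.
  have := ler_distD 0 1 (u (L + n)%N).
  rewrite subr0 normr1 sub0r normrN => h.
  rewrite rmorphB rmorph1 lerBlDr.
  have := lerB_dist 1 (u (L + n)%N); rewrite normr1 lerBlDr => /le_trans; apply.
  by rewrite lerD2l.
pose M := expR (K / (1 - r)); have M0 : 0 < M := expR_gt0 _.
have gL : `|gprod L| = (complex.Re `|gprod L|)%:C := real_of_ge0 (normr_ge0 _).
set g := complex.Re `|gprod L| in gL.
have g0' : 0 < g by rewrite -ltcR -gL normr_gt0.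
have M1 : 1 <= M by rewrite -expR0 ler_expR divr_ge0// ltW.
exists (Num.min (g / 2) (g / M)).
  by rewrite lt_min !divr_gt0.
move=> n; have [Ln|nL] := leqP L n.
  rewrite -(subnKC Ln) gprod_split normrM gL.
  apply: (@le_trans _ _ (g / 2)%:C); first by rewrite lecR ge_min lexx.
  by rewrite rmorphM; apply: ler_wpM2l => //; rewrite lecR ltW.
have := gprod_split n (L - n); rewrite subnKC; last exact: ltnW.
move/(congr1 (fun z : C => `|z|)); rewrite normrM gL => gE.
apply: (@le_trans _ _ (g / M)%:C); first by rewrite lecR ge_min lexx orbT.
have Mc : 0 < (M%:C : C) by rewrite ltcR.
have gM : (g / M)%:C * M%:C = g%:C :> C by rewrite -rmorphM /= divfK ?gt_eqF.
rewrite -(ler_pM2r Mc) gM gE ler_wpM2l//.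
exact: norm_prod_segment_le.
Qed.

Lemma gprod_cvg : cvgn gprod.
Proof.
pose M := expR (K / (1 - r)); have K0 := geo_const_ge0.
pose v n : C := gprod n.+1 - gprod n.
have vK n : `|v n| <= (M * K * r ^+ n)%:C.
  rewrite /v /gprod big_ord_recr /= mulrBr mulr1 addrAC subrr sub0r normrN normrM.
  by rewrite -mulrA rmorphM ler_pM// norm_gprod_le.
have /cvg_ex[l cl] : cvgn (series v) by exact: series_geometric_cvg vK.
apply/cvg_ex; exists (l + 1).
suff -> : gprod = (fun n => series v n + 1).
  by apply: cvgD; [exact: cl|exact: cvg_cst].
apply/funext => n.
by rewrite seriesEnat /= (@telescope_sumr_eq _ 0%N n gprod)// /gprod big_ord0 subrK.
Qed.

End GeometricProducts.

(** * The zeros of theta *)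

Section ThetaZeros.
Variable R : realType.
Local Notation C := (Cplx R).
Local Notation ipi := (ipi R : C).
Variable tau : C.
Hypothesis tau_gt0 : 0 < complex.Im tau.

Let q : C := cexp (2 * ipi * tau).
Let r : R := expR (- (2 * pi * complex.Im tau)).

Lemma norm_nome : `|q| = r%:C.
Proof.
rewrite norm_cexp /r; congr (expR _)%:C.
by rewrite !ReM !ImM /=; ring.
Qed.

Lemma nome_lt1 : r < 1.
Proof. by rewrite expR_lt1 oppr_lt0 !mulr_gt0// pi_gt0. Qed.

Lemma nome_powers (x : C) : exists K : R, forall k : nat,
  `|x * q ^+ k| <= (K * r ^+ k)%:C.
Proof.
exists (complex.Re `|x|) => k.
by rewrite normrM normrX norm_nome rmorphM rmorphXn /= -(real_of_ge0 (normr_ge0 x)).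
Qed.

Lemma nome_nroot (k : nat) : q ^+ k.+1 != 1.
Proof.
apply/eqP => /(congr1 (fun z : C => `|z|)).
rewrite normrX norm_nome normr1 -rmorphXn => /complexI rk.
have : r ^+ k.+1 < 1 by rewrite exprn_ilt1 ?expR_ge0 ?nome_lt1.
by rewrite rk ltxx.
Qed.

Lemma one_sub_nome_neq0 (k : nat) : 1 - q ^+ k.+1 != 0.
Proof. by rewrite subr_eq0 eq_sym nome_nroot. Qed.

Lemma qfact_bounds : exists M d : R, [/\ 0 < d,
   forall n, `|qfact q n| <= M%:C, forall n, d%:C <= `|qfact q n| & cvgn (qfact q)].
Proof.
have [K HK] := nome_powers q.
have HK' k : `|q ^+ k.+1| <= (K * r ^+ k)%:C by rewrite exprS.
have [d d0 dP] := norm_gprod_ge (expR_ge0 _) nome_lt1 HK' nome_nroot.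
exists (expR (K / (1 - r))), d; split => //.
- exact: (norm_gprod_le (expR_ge0 _) nome_lt1 HK').
- exact: (gprod_cvg (expR_ge0 _) nome_lt1 HK').
Qed.

(** For [- n <= j < n] this is the Gaussian binomial of [n + j] in [2 n - 1].  The
    absolute values only matter for the other [j], which are outside the [n]-th
    partial sum: they keep the weights bounded there, as dominated convergence
    requires. *)
Definition theta_weight (n : nat) (j : int) : C :=
  qfact q n.*2.-1 / (qfact q (absz (j + n%:Z)%R) * qfact q (absz (n%:Z - 1 - j)%R)).

Lemma cexp_nome (k : nat) : q ^+ k = cexp (2 * ipi * tau * k%:R).
Proof. by rewrite mulrC cexpM_nat. Qed.

(** Finite form of the Jacobi triple product.  It is the q-binomial theorem with
    [2 n + 1] factors, at the point [cexp xi] for which the summation index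
    [i = j + n + 1] turns the exponents into those of [theta_term]; [kap] is the
    exponent of the common factor of all terms. *)
Lemma finite_triple_product (c : C) (n : nat) :
  psum (fun j => theta_weight n.+1 j * theta_term tau c j) n.+1 =
  cexp (ipi * tau / 4 - ipi * (c + 2^-1)) *
  ((\prod_(k < n.+1) (1 - cexp (2 * ipi * c) * q ^+ k)) *
   (\prod_(k < n) (1 - cexp (- (2 * ipi * c)) * q ^+ k.+1))).
Proof.
pose xi := 2 * ipi * (c + 2^-1) - 2 * ipi * tau * n%:R.
pose kap := - (ipi * tau * (n%:R + 2^-1) ^+ 2) + 2 * ipi * (c + 2^-1) * (n%:R + 2^-1).
have neg y : - cexp y = cexp (ipi + y) by rewrite cexpD cexp_ipi mulN1r.
have := q_binomial one_sub_nome_neq0 (cexp xi) (n + n.+1).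
have -> : \prod_(k < n + n.+1) (1 + cexp xi * q ^+ k) =
  cexp (2 * ipi * (c + 2^-1) * n%:R - ipi * tau * n%:R * n.+1%:R) *
  ((\prod_(k < n.+1) (1 - cexp (2 * ipi * c) * q ^+ k)) *
   (\prod_(k < n) (1 - cexp (- (2 * ipi * c)) * q ^+ k.+1))).
  rewrite big_split_ord /= mulrC [RHS]mulrCA; congr (_ * _).
    apply: eq_bigr => k _; rewrite !cexp_nome -!cexpD neg; congr (_ + cexp _).
    by rewrite natrD /xi; field.
  rewrite (reindex_inj rev_ord_inj) /=.
  have -> : cexp (2 * ipi * (c + 2^-1) * n%:R - ipi * tau * n%:R * n.+1%:R) =
     \prod_(k < n) cexp (2 * ipi * (c + 2^-1) - 2 * ipi * tau * k.+1%:R).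
    elim: n {xi kap} => [|n IH]; first by rewrite big_ord0 !(mulr0, mul0r) subr0 cexp0.
    rewrite big_ord_recr /= -IH -cexpD; congr cexp.
    by rewrite -!natr1; ring.
  rewrite -big_split; apply: eq_bigr => k _ /=.
  rewrite mulrBr mulr1 !cexp_nome -!cexpD neg addrC; congr (cexp _ + _).
    by rewrite natrB// /xi; ring.
  by rewrite -[LHS](cexp_2ipiM R 1); congr cexp; field.
have term (i : nat) : q ^+ 'C(i, 2) * cexp xi ^+ i =
    cexp kap * theta_term tau c (i%:Z - n.+1%:Z).
  rewrite -cexpM_nat cexp_nome -!cexpD; congr cexp.
  have -> : 'C(i, 2)%:R = i%:R * (i%:R - 1) / 2 :> C.
    elim: i => [|i IH]; first by rewrite !mul0r.
    by rewrite binS bin1 natrD IH -natr1; field.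
  by rewrite intrB -!pmulrn -!natr1 /kap /xi; field.
move=> E.
apply: (mulfI (cexp_neq0 kap)); rewrite mulrA -cexpD.
rewrite (_ : kap + _ = 2 * ipi * (c + 2^-1) * n%:R - ipi * tau * n%:R * n.+1%:R); last first.
  by rewrite /kap -!natr1; field.
rewrite {}E.
under eq_bigr do rewrite -mulrA term mulrCA.
rewrite -big_distrr; congr (_ * _).
rewrite /psum big_split /=.
rewrite (_ : (n + n.+1).+1 = n.+1 + n.+1)%N; last by rewrite addSn.
rewrite big_split_ord /= addrC; congr (_ + _).
  rewrite (reindex_inj rev_ord_inj) /=; apply: eq_bigr => k _.
  rewrite /theta_weight /qbin; congr (_ / (_ * _) * _).
  - by congr qfact; lia.
  - by congr qfact; have := ltn_ord k; lia.
  - by congr qfact; have := ltn_ord k; lia.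
  - by congr theta_term; have := ltn_ord k; lia.
apply: eq_bigr => k _.
rewrite /theta_weight /qbin; congr (_ / (_ * _) * _).
- by congr qfact; lia.
- by congr qfact; lia.
- by congr qfact; have := ltn_ord k; lia.
- by congr theta_term; lia.
Qed.

Lemma cvg_reindex (v : nat -> C) (l : C) (phi : nat -> nat) (b : nat) :
  (forall n, (n <= phi n + b)%N) -> v @ \oo --> l -> (v \o phi) @ \oo --> l.
Proof.
move=> phib vl; apply/cvgrPdist_le => e e0.
move/cvgrPdist_le : vl => /(_ _ e0)[m _ vm].
exists (m + b)%N => // n /= mn; apply: vm => /=.
by have := phib n; lia.
Qed.

Lemma theta_weight_cvg (L : C) (j : int) : L != 0 -> qfact q @ \oo --> L ->
  (fun n => theta_weight n j) @ \oo --> L^-1.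
Proof.
move=> L0 qL; rewrite (_ : L^-1 = L * (L * L)^-1); last by field.
apply: cvgM; first by apply: (@cvg_reindex _ _ (fun n => n.*2.-1) 1%N) qL => n; lia.
apply: cvgV; first by rewrite mulf_neq0.
apply: cvgM.
- by apply: (@cvg_reindex _ _ (fun n => absz (j + n%:Z)%R) (absz j)) qL => n; lia.
- by apply: (@cvg_reindex _ _ (fun n => absz (n%:Z - 1 - j)%R) (absz j).+1) qL => n; lia.
Qed.

(** If [c] is not in the lattice, all factors of the triple product are non-zero,
    hence the product stays away from zero, and so does its limit, which is a
    non-zero multiple of [theta tau c]. *)
Lemma theta_eq0_lattice (c : C) : theta tau c = 0 -> lattice tau c.
Proof.
move=> c0; apply: contrapT => nlat.
have [M [d [d0 qM qd /cvg_ex[L qL]]]] := qfact_bounds.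
have dc : 0 < (d%:C : C) by rewrite ltcR.
have L0 : L != 0.
  rewrite -normr_gt0; apply: (lt_le_trans dc).
  apply/ler_addgt0Pr => e e0.
  have /cvgrPdist_le/(_ _ e0)[n _ /(_ n (leqnn n)) Ln] := qL.
  apply: (le_trans (qd n)); rewrite addrC -lerBlDr.
  by apply: (le_trans (lerB_dist _ _)); rewrite distrC.
have [K HK] := theta_term_bounded tau_gt0 c.
have K0 := bounded_ge0 HK.
have HKL := boundedZ L^-1 HK.
have cF : (fun n => psum (fun j => theta_weight n j * theta_term tau c j) n) @ \oo --> (0 : C).
  have -> : 0 = sum_int (fun j => L^-1 * theta_term tau c j).
    rewrite (sum_intZ _ HK) (_ : sum_int _ = 0) ?mulr0//.
    by apply/eqP; rewrite -oppr_eq0; apply/eqP.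
  pose K' := (M%:C / (d%:C * d%:C)) * K + `|L^-1| * K.
  have M0 : 0 <= (M%:C : C) by exact: le_trans (qM 0%N).
  have Md0 : 0 <= (M%:C / (d%:C * d%:C) : C) by rewrite divr_ge0// mulr_ge0// ltW.
  apply: (@tannery _ K'); last 2 first.
  - move=> j; apply: (le_trans (HKL j)); rewrite ler_wpM2r ?decay_ge0// lerDr mulr_ge0//.
  - move=> j; apply: cvgM; last exact: cvg_cst.
    exact: theta_weight_cvg.
  move=> n j; apply: (@le_trans _ _ ((M%:C / (d%:C * d%:C)) * K * decay R j)); last first.
    by rewrite ler_wpM2r ?decay_ge0// lerDl mulr_ge0.
  rewrite normrM -mulrA; apply: ler_pM => //.
  rewrite normrM normfV normrM; apply: ler_pM => //.
  have pos k : 0 < `|qfact q k| := lt_le_trans dc (qd k).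
  rewrite lef_pV2 ?posrE; [|by rewrite mulr_gt0..].
  by apply: ler_pM; rewrite // ltW.
have [K1 HK1] := nome_powers (cexp (2 * ipi * c)).
have [K2 HK2] := nome_powers (cexp (- (2 * ipi * c)) * q).
have HK2' k : `|cexp (- (2 * ipi * c)) * q ^+ k.+1| <= (K2 * r ^+ k)%:C.
  by rewrite exprS mulrA.
have ipi2 : 2 * ipi != 0 :> C.
  by rewrite mulf_neq0// -normr_gt0 norm_ipi ltcR pi_gt0.
have u1 k : cexp (2 * ipi * c) * q ^+ k != 1.
  apply/eqP; rewrite cexp_nome -cexpD => /cexp_eq1[p pE]; apply: nlat.
  exists p, (- k%:Z); apply: (mulfI ipi2); rewrite mulrDr -pE intrN -pmulrn; ring.
have v1 k : cexp (- (2 * ipi * c)) * q ^+ k.+1 != 1.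
  apply/eqP; rewrite cexp_nome -cexpD => /cexp_eq1[p pE]; apply: nlat.
  exists (- p), k.+1; apply: (mulfI ipi2).
  by rewrite mulrDr intrN mulrN -pE -pmulrn; ring.
have [d1 d10 P1] := norm_gprod_ge (expR_ge0 _) nome_lt1 HK1 u1.
have [d2 d20 P2] := norm_gprod_ge (expR_ge0 _) nome_lt1 HK2' v1.
set rho := cexp (ipi * tau / 4 - ipi * (c + 2^-1)).
have e0 : 0 < `|rho| * (d1%:C * d2%:C).
  by rewrite !mulr_gt0 ?normr_gt0 ?cexp_neq0 ?ltcR.
have e2 : 0 < `|rho| * (d1%:C * d2%:C) / 2 by rewrite divr_gt0.
have /cvgrPdist_le/(_ _ e2)[n _ /(_ n.+1 (leqnSn n))] := cF.
rewrite /= sub0r normrN finite_triple_product -/rho normrM normrM => h.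
have h' : `|rho| * (d1%:C * d2%:C) <= `|rho| * (d1%:C * d2%:C) / 2.
  by apply: le_trans h; rewrite ler_wpM2l// ler_pM// lecR ltW.
move: h'; rewrite (ler_pMr _ e0) => /le_lt_trans h'.
by have := h' 1; rewrite invf_lt1// ltr1n ltxx => /(_ isT).
Qed.

End ThetaZeros.

(** * Generic points *)

Section GenericPoints.
Variable R : realType.
Local Notation C := (Cplx R).
Variable tau : C.
Hypothesis tau_gt0 : 0 < complex.Im tau.

(** The zeros of theta are countable, so finitely many translates of them,
    rescaled to a real line, cannot cover an interval. *)
Lemma theta_line_neq0 (s : seq (C * C)) (e : R) :
  (forall p, p \in s -> p.2 != 0) -> 0 < e ->
  exists t : R, [/\ 0 < t, t < e & forall p, p \in s -> theta tau (p.1 + t%:C * p.2) != 0].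
Proof.
move=> s0 e0; apply: contrapT => no_t.
pose f (x : nat * int * int) : R :=
  let p := nth 0 s x.1.1 in complex.Re ((x.1.2%:~R + x.2%:~R * tau - p.1) / p.2).
have cnt : countable (range f) by apply: sub_countable (card_image_le f setT) _.
have sub : `]0, e[%classic `<=` range f.
  move=> t; rewrite /= in_itv /= => /andP[t0 te]; apply: contrapT => nf.
  apply: no_t; exists t; split => // p ps; apply/eqP => /(theta_eq0_lattice tau_gt0).
  move=> [a [b pE]]; apply: nf; exists (index p s, a, b) => //.
  rewrite /f /= nth_index// -pE addrAC subrr add0r mulfK//; exact: s0.
have := countable_lebesgue_measure0 (sub_countable (subset_card_le sub) cnt).
rewrite lebesgue_measure_itv /= lte_fin e0 sube0 => /eqP.
by rewrite eqe gt_eqF.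
Qed.

Lemma theta_continuous : continuous (theta tau : C -> C).
Proof.
move=> x; apply: differentiable_continuous; apply/derivable1_diffP.
exact: theta_derivable.
Qed.

Section Continuity.
Variable T : topologicalType.
Implicit Types f g : T -> C.

Lemma continuous_addf f g : continuous f -> continuous g ->
  continuous (fun x => f x + g x).
Proof. by move=> fc gc x; apply: cvgD; [exact: fc|exact: gc]. Qed.

Lemma continuous_oppf f : continuous f -> continuous (fun x => - f x).
Proof. by move=> fc x; apply: cvgN; exact: fc. Qed.

Lemma continuous_mulf f g : continuous f -> continuous g ->
  continuous (fun x => f x * g x).
Proof. by move=> fc gc x; apply: cvgM; [exact: fc|exact: gc]. Qed.

Lemma continuous_cstf (c : C) : continuous (fun _ : T => c).
Proof. by move=> x; exact: cvg_cst. Qed.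

Lemma continuous_thetaf f : continuous f -> continuous (fun x => theta tau (f x)).
Proof.
by move=> fc x; apply: continuous_comp; [exact: fc|exact: theta_continuous].
Qed.

Lemma continuous_sumf I (s : seq I) (P : pred I) (F : I -> T -> C) :
  (forall i, continuous (F i)) -> continuous (fun x => \sum_(i <- s | P i) F i x).
Proof.
move=> Fc; apply: continuous_big => [|i _]; [exact: add_continuous|exact: Fc].
Qed.

Lemma continuous_prodf I (s : seq I) (P : pred I) (F : I -> T -> C) :
  (forall i, continuous (F i)) -> continuous (fun x => \prod_(i <- s | P i) F i x).
Proof.
move=> Fc; apply: continuous_big => [|i _]; [exact: mul_continuous|exact: Fc].
Qed.

End Continuity.

(** Removes finitely many genericity assumptions from an identity between
    continuous functions. *)
Lemma eq0_of_generic (f : C -> C) (s : seq C) : {for 0, continuous f} ->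
  (forall h, (forall c, c \in s -> theta tau (c + h) != 0) -> f h = 0) -> f 0 = 0.
Proof.
move=> fc fs; apply/eqP; rewrite -normr_le0; apply/ler_addgt0Pr => e e0; rewrite add0r.
have /cvgrPdist_le/(_ _ e0)/nbhs_ballP[d d0 fd] := fc.
have dE : d = (complex.Re d)%:C := real_of_ge0 (ltW d0).
have d0' : 0 < complex.Re d by rewrite -ltcR -dE.
have [|t [t0 td ts]] := @theta_line_neq0 [seq (c, 1) | c <- s] (complex.Re d) _ d0'.
  by move=> p /mapP[c _ ->]; rewrite /= oner_eq0.
have ft : f t%:C = 0.
  by apply: fs => c cs; have := ts (c, 1); rewrite mulr1; apply; exact: map_f.
have := fd t%:C; rewrite /= ft subr0; apply.
rewrite /ball /= sub0r normrN ger0_norm ?lecR ?(ltW t0)//.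
by rewrite dE ltcR.
Qed.

End GenericPoints.

(** * Elliptic partial fractions *)

Section PartialFractions.
Variable R : realType.
Local Notation C := (Cplx R).
Variable tau : C.
Hypothesis tau_gt0 : 0 < complex.Im tau.
Implicit Types (s t : seq C) (a b : C).
Local Notation th := (theta tau).

(** The nodes, listed without repetition, index the sum themselves, so that a node
    can be removed or moved to the front without reindexing.  Up to the factor
    [theta' 0] this is the sum of the residues, at the nodes [s], of the product
    of the [th (v - b)] over that of the [th (v - x)]. *)
Definition theta_residue_sum s t : C :=
  \sum_(x <- s) (\prod_(b <- t) th (x - b)) / \prod_(y <- s | y != x) th (x - y).

Definition theta_separated s := {in s &, forall x y, x != y -> th (x - y) != 0}.

Lemma perm_residue_sum s s' t : perm_eq s s' ->
  theta_residue_sum s t = theta_residue_sum s' t.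
Proof.
move=> ss'; rewrite /theta_residue_sum (perm_big s')//.
by apply: eq_bigr => x _; congr (_ / _); apply: perm_big.
Qed.

Lemma residue_sum_cancel a s t : uniq (a :: s) -> theta_separated (a :: s) ->
  theta_residue_sum (a :: s) (a :: t) = theta_residue_sum s t.
Proof.
move=> /= /andP[as_ us] sep.
rewrite /theta_residue_sum big_cons big_cons subrr (theta0 tau_gt0) !mul0r add0r.
apply: eq_big_seq => x xs.
have ax : a != x by apply: contraNneq as_ => ->.
rewrite !big_cons ax; have xa : th (x - a) != 0.
  by apply: sep; rewrite ?inE ?eqxx ?xs ?orbT// eq_sym.
by rewrite -mulf_div divff// mul1r.
Qed.

Lemma residue_sum_three_term a1 a2 b1 b2 s t :
  th (a1 - a2) * (th (b1 + b2 - a1 - a2) * theta_residue_sum s (b1 :: b2 :: t)) =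
  th (b1 - a2) * th (b2 - a2) * theta_residue_sum s (a1 :: b1 + b2 - a1 :: t)
  - th (b1 - a1) * th (b2 - a1) * theta_residue_sum s (a2 :: b1 + b2 - a2 :: t).
Proof.
have key (A B c d e f g k l m X Y P D : C) :
    A * B * (X * Y) = c * d * (e * f) - g * k * (l * m) ->
    A * (B * (X * (Y * P) * D)) = c * d * (e * (f * P) * D) - g * k * (l * (m * P) * D).
  by move=> E; transitivity (A * B * (X * Y) * P * D); [ring|rewrite E; ring].
rewrite /theta_residue_sum !big_distrr /= -sumrB; apply: eq_bigr => x _.
by rewrite !big_cons; apply: key; exact: theta_three_term.
Qed.

Lemma residue_sum_shift_continuous b1 b2 b3 s t :
  {for 0, continuous (fun h : C => theta_residue_sum s (b1 + h :: b2 :: b3 - h :: t))}.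
Proof.
move: (0 : C); apply: continuous_sumf => x.
apply: continuous_mulf; last exact: continuous_cstf.
rewrite (_ : (fun h => _) = (fun h => th (x - (b1 + h)) * (th (x - b2) *
  (th (x - (b3 - h)) * \prod_(b <- t) th (x - b))))); last first.
  by apply/funext => h; rewrite !big_cons.
have cid : continuous (fun h : C => h) by move=> h; exact: cvg_id.
apply: continuous_mulf.
  apply: (continuous_thetaf tau_gt0); apply: continuous_addf; first exact: continuous_cstf.
  by apply: continuous_oppf; apply: continuous_addf; [exact: continuous_cstf|].
apply: continuous_mulf; first exact: continuous_cstf.
apply: continuous_mulf; last exact: continuous_cstf.
apply: (continuous_thetaf tau_gt0); apply: continuous_addf; first exact: continuous_cstf.
apply: continuous_oppf; apply: continuous_addf; first exact: continuous_cstf.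
exact: continuous_oppf.
Qed.

(** Residue theorem, by induction on the number of nodes.  The three-term relation
    writes two factors of the numerator, with roots [b1] and [b2], as a combination
    of a product that vanishes at the node [a1] and one that vanishes at [a2]; in
    either case a node cancels.  This determines the sum only up to the factor
    [th (b1 + b2 - a1 - a2)], which may be zero: moving [b1] and [b3] by [h] and
    [- h] keeps the sum of the roots and makes the factor non-zero for small
    generic [h]. *)
Theorem theta_residue_sum_eq0 s t : uniq s -> theta_separated s ->
  size t = size s -> \sum_(x <- s) x = \sum_(b <- t) b -> theta_residue_sum s t = 0.
Proof.
move: {2}(size s) (erefl (size s)) => n; elim: n s t => [|n IH] s t sn us sep st sum_st.
  by move/size0nil : sn => ->; rewrite /theta_residue_sum big_nil.
case: s us sep st sum_st sn => [//|a1 [|a2 s]] us sep st sum_st [sn].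
  case: t st sum_st => [//|b [|//]] _; rewrite !big_seq1 => ->.
  by rewrite /theta_residue_sum !big_seq1 subrr (theta0 tau_gt0) mul0r.
have th12 : th (a1 - a2) != 0.
  by apply: sep; rewrite ?inE ?eqxx ?orbT//; move: us; rewrite /= inE negb_or => /andP[/andP[]].
have th21 : th (a2 - a1) != 0 by rewrite -opprB theta_odd// oppr_eq0.
case: t st sum_st => [//|b1 [//|b2 [|b3 t]]] /= [st] sum_st.
  have s0 : s = [::] by apply: size0nil.
  subst s; move: sum_st; rewrite !big_cons !big_nil !addr0 => sum_st.
  have n12 : a2 != a1 by apply: contraNneq th12 => ->; rewrite subrr theta0.
  have n21 : a1 != a2 by rewrite eq_sym.
  rewrite /theta_residue_sum; do ?rewrite !(big_cons, big_nil, eqxx, n12, n21, mulr1, addr0) /=.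
  rewrite (_ : a1 - b2 = b1 - a2); last by rewrite -[b2](addKr b1) -sum_st; ring.
  rewrite (_ : a2 - b2 = b1 - a1); last by rewrite -[b2](addKr b1) -sum_st; ring.
  rewrite -(opprB a1 b1) -(opprB a1 a2) -(opprB a2 b1) !theta_odd//; field.
  by [].
have usw : uniq (a2 :: a1 :: s).
  by rewrite -(perm_uniq (s1 := [:: a1, a2 & s])) // (perm_catCA [:: a1] [:: a2] s).
have pe : perm_eq [:: a1, a2 & s] [:: a2, a1 & s] by rewrite (perm_catCA [:: a1] [:: a2] s).
have sepw : theta_separated (a2 :: a1 :: s).
  by move=> x y; rewrite -!(perm_mem pe); exact: sep.
have sub1 : theta_separated (a2 :: s).
  by move=> x y xs ys; apply: sep; rewrite inE ?xs ?ys orbT.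
have sub2 : theta_separated (a1 :: s).
  by move=> x y xs ys; apply: sepw; rewrite inE ?xs ?ys orbT.
pose f h := theta_residue_sum [:: a1, a2 & s] (b1 + h :: b2 :: b3 - h :: t).
have f0 : f 0 = 0.
  apply: (eq0_of_generic tau_gt0 (s := [:: b1 + b2 - a1 - a2])).
    exact: residue_sum_shift_continuous.
  move=> h /(_ _ (mem_head _ _)) hne; apply: (mulfI (mulf_neq0 th12 hne)).
  rewrite mulr0 -mulrA {hne}.
  rewrite (_ : b1 + b2 - a1 - a2 + h = (b1 + h) + b2 - a1 - a2); last by ring.
  rewrite residue_sum_three_term residue_sum_cancel//.
  rewrite (perm_residue_sum _ pe) residue_sum_cancel//.
  move: us usw => /= /andP[_ us1] /andP[_ us2].
  move: sum_st; rewrite !big_cons => sum_st.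
  rewrite !IH ?mulr0 ?subr0 //=; rewrite ?st ?sn// !big_cons.
    by apply: (addrI a2); rewrite addrCA sum_st; ring.
  by apply: (addrI a1); rewrite sum_st; ring.
by move: f0; rewrite /f addr0 subr0.
Qed.

End PartialFractions.

(** * Baxter's equation and theta interpolation *)

Section BetheAnsatz.
Variables (R : realType) (n m : nat).
Local Notation C := (Cplx R).
Variables (tau eta : C) (z : 'I_n -> C) (Lambda : 'I_n -> nat) (a : C) (w : 'I_m -> C).
Hypothesis tau_gt0 : 0 < complex.Im tau.
Local Notation th := (theta tau).
Local Notation Ap := (A_plus tau eta z Lambda).
Local Notation Am := (A_minus tau eta z Lambda).
Local Notation Q := (Qfun tau a w).
Implicit Types x : 'rV[C]_n.

(** Baxter's expression without its factor [cexp (a * v)], which would not be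
    compatible with the partial fraction identity. *)
Definition baxter_num (v : C) : C :=
  cexp (- (2 * a * eta)) * (Ap v * \prod_(k < m) th (v - w k - 2 * eta))
  + cexp (2 * a * eta) * (Am v * \prod_(k < m) th (v - w k + 2 * eta)).

Lemma baxter_numE (v : C) :
  Ap v * Q (v - 2 * eta) + Am v * Q (v + 2 * eta) = cexp (a * v) * baxter_num v.
Proof.
rewrite /Qfun /baxter_num.
have -> : cexp (a * (v - 2 * eta)) = cexp (a * v) * cexp (- (2 * a * eta)).
  by rewrite -cexpD; congr cexp; ring.
have -> : cexp (a * (v + 2 * eta)) = cexp (a * v) * cexp (2 * a * eta).
  by rewrite -cexpD; congr cexp; ring.
rewrite mulrDr; congr (_ + _).
  under eq_bigr do rewrite addrAC; ring.
under eq_bigr do rewrite addrAC; ring.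
Qed.

(** The factors of index [i] in the two products are [th (- 2 * eta)] and
    [th (2 * eta)]; once they are taken out, the Bethe equation of index [i] makes
    the two terms cancel. *)
Lemma baxter_num_root (i : 'I_m) :
  bethe_equations tau eta z Lambda a w -> baxter_num (w i) = 0.
Proof.
move=> /(_ i); rewrite /baxter_num.
set P := \prod_(_ < _ | _) _; set P' := \prod_(_ < _ | _) _ => E.
have -> : \prod_(k < m) th (w i - w k - 2 * eta) = - th (2 * eta) * P.
  by rewrite (bigD1 i)//= subrr sub0r theta_odd.
have -> : \prod_(k < m) th (w i - w k + 2 * eta) = th (2 * eta) * P'.
  by rewrite (bigD1 i)//= subrr add0r.
have e4 : cexp (2 * a * eta) = cexp (- (2 * a * eta)) * cexp (4 * a * eta).
  by rewrite -cexpD; congr cexp; ring.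
rewrite e4.
set c := cexp (- (2 * a * eta)); set t := th (2 * eta).
transitivity (c * t * (- (Ap (w i) * P) + cexp (4 * a * eta) * Am (w i) * P')); first by ring.
by rewrite E addNr mulr0.
Qed.

Section Interpolation.
Hypothesis bethe : bethe_equations tau eta z Lambda a w.
Hypothesis sumLambda : (\sum_(k < n) Lambda k = 2 * m)%N.
Hypothesis w_sep : forall i j : 'I_m, i != j -> th (w i - w j) != 0.
Variables (x : 'rV[C]_n) (y : C).
Hypothesis x_sep : forall i j : 'I_n, i != j -> th (x 0 i - x 0 j) != 0.
Hypothesis xw_sep : forall (i : 'I_n) (k : 'I_m), th (x 0 i - w k) != 0.
Hypothesis yx_sep : forall i : 'I_n, th (y - x 0 i) != 0.
Hypothesis yw_sep : forall k : 'I_m, th (y - w k) != 0.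

Let X := [seq x 0 i | i <- index_enum 'I_n].
Let W := [seq w k | k <- index_enum 'I_m].
Let nodes := y :: X ++ W.

Lemma theta_sub_sym (u v : C) : th (u - v) != 0 -> th (v - u) != 0.
Proof. by move=> h; rewrite -opprB theta_odd// oppr_eq0. Qed.

Lemma neq_of_theta (u v : C) : th (u - v) != 0 -> u != v.
Proof. by apply: contraNneq => ->; rewrite subrr theta0. Qed.

Lemma X_inj : injective (fun i => x 0 i).
Proof.
move=> i j ij; apply/eqP; apply: contraT => /x_sep/neq_of_theta.
by rewrite ij eqxx.
Qed.

Lemma w_inj : injective w.
Proof.
move=> i j ij; apply/eqP; apply: contraT => /w_sep/neq_of_theta.
by rewrite ij eqxx.
Qed.

Lemma nodes_uniq : uniq nodes.
Proof.
have uX : uniq X by rewrite map_inj_uniq ?index_enum_uniq//; exact: X_inj.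
have uW : uniq W by rewrite map_inj_uniq ?index_enum_uniq//; exact: w_inj.
rewrite /= mem_cat cat_uniq uX uW negb_or andbT; apply/andP; split.
  apply/andP; split; apply/mapP => -[i _ /eqP yi].
    by move/neq_of_theta: (yx_sep i); rewrite yi.
  by move/neq_of_theta: (yw_sep i); rewrite yi.
apply/hasPn => _ /mapP[k _ ->]; apply/mapP => -[i _ /eqP xk].
by move/neq_of_theta: (xw_sep i k); rewrite eq_sym xk.
Qed.

Lemma nodes_separated : theta_separated tau nodes.
Proof.
move=> u v; rewrite !inE !mem_cat => /orP[/eqP->|/orP[/mapP[i _ ->]|/mapP[i _ ->]]]
  /orP[/eqP->|/orP[/mapP[j _ ->]|/mapP[j _ ->]]] uv //.
- by rewrite eqxx in uv.
- by apply: theta_sub_sym; exact: yx_sep.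
- by apply: x_sep; apply: contraNneq uv => ->.
- by apply: theta_sub_sym; exact: yw_sep.
- by apply: theta_sub_sym; exact: xw_sep.
- by apply: w_sep; apply: contraNneq uv => ->.
Qed.

Let node_den v := \prod_(v' <- nodes | v' != v) th (v - v').

(** The two shifts are left free so that both terms of [baxter_num] are covered:
    [c k = eta * Lambda k], [e = - 2 * eta] and the opposite choice.  The hypothesis
    makes the zeros of the numerator add up to the nodes. *)
Lemma node_residues_sum_eq0 (c : 'I_n -> C) (e : C) : \sum_k c k + m%:R * e = 0 ->
  \sum_(v <- nodes) th (v - y + lam z x) *
    (\prod_(k < n) th (v + z k + c k) * \prod_(k < m) th (v - w k + e)) / node_den v = 0.
Proof.
move=> ce.
pose zs := [seq - z k - c k | k <- index_enum 'I_n].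
pose ws := [seq w k - e | k <- index_enum 'I_m].
have sumE : \sum_(v <- nodes) v = \sum_(b <- y - lam z x :: zs ++ ws) b.
  rewrite !big_cons !big_cat !big_map /lam /=.
  rewrite -![\sum_(_ <- _) _]/(\sum_i _).
  rewrite !big_split /= !sumrN sumr_const card_ord -mulr_natl.
  apply: (addrI (\sum_k c k + m%:R * e)); rewrite {1}ce; ring.
apply: etrans (theta_residue_sum_eq0 tau_gt0 nodes_uniq nodes_separated _ sumE); last first.
  by rewrite /= !size_cat !size_map.
apply: eq_bigr => v _; congr (_ / _).
rewrite big_cons big_cat !big_map /= opprB addrA; congr (_ * (_ * _)).
- by rewrite addrAC.
- by apply: eq_bigr => k _; congr th; ring.
- by apply: eq_bigr => k _; congr th; ring.
Qed.

Lemma sum_eta_Lambda : \sum_k eta * (Lambda k)%:R = 2 * m%:R * eta :> C.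
Proof. by rewrite -mulr_sumr -natr_sum sumLambda natrM mulrC. Qed.

Lemma node_den_y : node_den y = \prod_(j < n) th (y - x 0 j) * \prod_(k < m) th (y - w k).
Proof.
rewrite /node_den big_cons eqxx /= big_cat !big_map; congr (_ * _).
- by apply: eq_bigl => j; rewrite eq_sym neq_of_theta.
- by apply: eq_bigl => j; rewrite eq_sym neq_of_theta.
Qed.

Lemma node_den_x i : node_den (x 0 i) = th (x 0 i - y) *
  (\prod_(j < n | j != i) th (x 0 i - x 0 j) * \prod_(k < m) th (x 0 i - w k)).
Proof.
rewrite /node_den big_cons (neq_of_theta (yx_sep i)) big_cat !big_map.
congr (_ * (_ * _)).
- by apply: eq_bigl => j; rewrite (inj_eq X_inj).
- by apply: eq_bigl => j; rewrite eq_sym neq_of_theta.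
Qed.

(** The residues at the [w k] drop out by the Bethe equations. *)
Lemma baxter_interpolation :
  th (lam z x) * baxter_num y / node_den y +
  \sum_(i < n) th (x 0 i - y + lam z x) * baxter_num (x 0 i) / node_den (x 0 i) = 0.
Proof.
have all0 : \sum_(v <- nodes) th (v - y + lam z x) * baxter_num v / node_den v = 0.
  have h1 : \sum_(v <- nodes) th (v - y + lam z x) *
      (Ap v * \prod_(k < m) th (v - w k - 2 * eta)) / node_den v = 0.
    by apply: node_residues_sum_eq0; rewrite sum_eta_Lambda; ring.
  have h2 : \sum_(v <- nodes) th (v - y + lam z x) *
      (Am v * \prod_(k < m) th (v - w k + 2 * eta)) / node_den v = 0.
    by apply: node_residues_sum_eq0; rewrite sumrN sum_eta_Lambda; ring.
  have split_num (A B B' D c c' : C) :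
      A * (c * B + c' * B') / D = c * (A * B / D) + c' * (A * B' / D) by ring.
  rewrite (eq_bigr _ (fun v _ => split_num _ _ _ _ _ _)) big_split /=.
  by rewrite -!mulr_sumr h1 h2 !mulr0 addr0.
move: all0; rewrite big_cons subrr add0r big_cat !big_map.
rewrite [X in _ + (_ + X)]big1 ?addr0// => k _.
by rewrite baxter_num_root// mulr0 mul0r.
Qed.

(** [baxter_interpolation] multiplied by the factors that turn its denominators
    into those of the operator; the sign comes from [th (x i - y) = - th (y - x i)]. *)
Lemma transfer_generic : th (lam z x) != 0 ->
  transfer_opp tau eta z Lambda y (fun x => \prod_(i < n) Q (x 0 i)) x =
  baxter_num y / \prod_(k < m) th (y - w k) * \prod_(i < n) Q (x 0 i).
Proof.
move=> l0.
have Py0 : \prod_(j < n) th (y - x 0 j) != 0 by apply/prodf_neq0.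
have Wy0 : \prod_(k < m) th (y - w k) != 0 by apply/prodf_neq0.
have shiftE i h : \prod_(j < n) Q (shift_coord x i h 0 j) =
    Q (x 0 i + h) * \prod_(j < n | j != i) Q (x 0 j).
  rewrite (bigD1 i)//= /shift_coord !mxE !eqxx mulr1; congr (_ * _).
  by apply: eq_bigr => j ji; rewrite !mxE (negbTE ji) mulr0 addr0.
have term_key (A B L Py Px E QQ V t : C) : L != 0 -> Px != 0 -> V != 0 -> t != 0 ->
    A / L * (Py / Px) * (E * B * QQ)
    = - (E * V * QQ * (t * Py) / L * (A * B / (- t * (Px * V)))).
  by move=> L0 P0 V0 t0; field; rewrite L0 P0 V0 t0.
have term i : th (lam z x - y + x 0 i) / th (lam z x)
    * (\prod_(j < n | j != i) (th (y - x 0 j) / th (x 0 i - x 0 j)))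
    * (Ap (x 0 i) * \prod_(j < n) Q (shift_coord x i (- (2 * eta)) 0 j)
       + Am (x 0 i) * \prod_(j < n) Q (shift_coord x i (2 * eta) 0 j))
  = - ((\prod_(i < n) Q (x 0 i)) * (\prod_(j < n) th (y - x 0 j)) / th (lam z x) *
    (th (x 0 i - y + lam z x) * baxter_num (x 0 i) / node_den (x 0 i))).
  have d0 : \prod_(j < n | j != i) th (x 0 i - x 0 j) != 0.
    by apply/prodf_neq0 => j ji; apply: x_sep; rewrite eq_sym.
  have e0 : \prod_(k < m) th (x 0 i - w k) != 0 by apply/prodf_neq0.
  apply: etrans (etrans _ (term_key (th (x 0 i - y + lam z x)) (baxter_num (x 0 i)) _
    (\prod_(j < n | j != i) th (y - x 0 j)) _ (cexp (a * x 0 i))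
    (\prod_(j < n | j != i) Q (x 0 j)) _ _ l0 d0 e0 (yx_sep i))) _.
    congr (_ / _ * _ * _).
    - by congr th; ring.
    - exact: prodf_div.
    - rewrite -baxter_numE [RHS]mulrDl; congr (_ + _); rewrite -[RHS]mulrA; congr (_ * _);
        exact: shiftE.
  congr (- (_ * _ / _ * (_ / _))).
  - by rewrite [RHS](bigD1 i).
  - by rewrite [RHS](bigD1 i).
  - by rewrite node_den_x -(opprB y) theta_odd.
rewrite /transfer_opp (eq_bigr _ (fun i _ => term i)) sumrN -mulr_sumr.
have := baxter_interpolation; rewrite addrC => /eqP; rewrite addr_eq0 => /eqP ->.
rewrite node_den_y mulrN opprK.
have final_key (P Y L B V : C) : L != 0 -> Y != 0 -> V != 0 ->
    P * Y / L * (L * B / (Y * V)) = B / V * P.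
  by move=> L0 Y0 V0; field; rewrite L0 Y0 V0.
exact: final_key.
Qed.

End Interpolation.

End BetheAnsatz.

(** * The common eigenfunction *)

Section Eigenfunction.
Variables (R : realType) (n m : nat).
Local Notation C := (Cplx R).
Variables (tau eta : C) (z : 'I_n -> C) (Lambda : 'I_n -> nat) (a : C) (w : 'I_m -> C).
Hypothesis tau_gt0 : 0 < complex.Im tau.
Local Notation th := (theta tau).
Local Notation Q := (Qfun tau a w).
Implicit Types x : 'rV[C]_n.

Definition bethe_vector x : C := \prod_(i < n) Q (x 0 i).

Lemma differentiable_prodf (V : normedModType C) I (s : seq I) (F : I -> V -> C) (v : V) :
  (forall i, differentiable (F i) v) ->
  differentiable (fun u => \prod_(i <- s) F i u) v.
Proof.
move=> Fv; elim: s => [|i s IH].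
  rewrite (_ : (fun u => _) = (fun=> 1)); first exact: differentiable_cst.
  by apply/funext => u; rewrite big_nil.
rewrite (_ : (fun u => _) = F i * (fun u => \prod_(j <- s) F j u)).
  exact: differentiableM.
by apply/funext => u; rewrite big_cons.
Qed.

Lemma Qfun_differentiable (v : C) : differentiable (Q : C -> C) v.
Proof.
have did : differentiable (fun u : C => u) v.
  by apply: (@linear_differentiable C C C idfun) => u; exact: cvg_id.
have dcst (c : C) : differentiable (fun _ : C => c) v by exact: differentiable_cst.
have dexp : differentiable (fun u => cexp (a * u)) v.
  apply: (@differentiable_comp _ _ _ _ (fun u => a * u) (@cexp R)).
    exact: (differentiableM (dcst a) did).
  by apply/derivable1_diffP; exact: cexp_derivable.
have dprod : differentiable (fun u => \prod_(k < m) th (u - w k)) v.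
  apply: differentiable_prodf => k.
  apply: (@differentiable_comp _ _ _ _ (fun u => u - w k) th).
    exact: (differentiableB did (dcst (w k))).
  by apply/derivable1_diffP; exact: theta_derivable.
exact: (differentiableM dexp dprod).
Qed.

Lemma bethe_vector_differentiable x : differentiable bethe_vector x.
Proof.
apply: differentiable_prodf => i.
apply: (@differentiable_comp _ _ _ _ (fun x : 'rV[C]_n => x 0 i : C) (Q : C -> C)).
  exact: differentiable_coord.
exact: Qfun_differentiable.
Qed.

Lemma bethe_vector_meromorphic : meromorphic bethe_vector.
Proof.
move=> p; exists bethe_vector, (fun=> 1); split.
- by apply: (@filterE _ (nbhs p) (nbhs_filter p)) => x; exact: bethe_vector_differentiable.
- by apply: (@filterE _ (nbhs p) (nbhs_filter p)) => x; exact: differentiable_cst.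
- by move=> /nbhs_singleton/eqP; rewrite oner_eq0.
- by apply: (@filterE _ (nbhs p) (nbhs_filter p)) => x _; rewrite divr1.
Qed.

Lemma coord_continuous i : continuous (fun x : 'rV[C]_n => x 0 i : C).
Proof. by move=> x; apply: differentiable_continuous; exact: differentiable_coord. Qed.

Lemma lam_continuous : continuous (lam z : 'rV[C]_n -> C).
Proof.
apply: continuous_oppf; apply: continuous_sumf => k.
by apply: continuous_addf; [exact: coord_continuous|exact: continuous_cstf].
Qed.

(** A single continuous function whose zeros are the [x] to be avoided, which makes
    openness of the generic set immediate. *)
Definition generic_val x : C :=
  th (lam z x) * (\prod_(ij : 'I_n * 'I_n | ij.1 != ij.2) th (x 0 ij.1 - x 0 ij.2)
  * \prod_(ik : 'I_n * 'I_m) th (x 0 ik.1 - w ik.2)).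

Definition generic_set : set 'rV[C]_n := [set x | generic_val x != 0].

Lemma generic_setP x : generic_set x -> [/\ th (lam z x) != 0,
  forall i j : 'I_n, i != j -> th (x 0 i - x 0 j) != 0 &
  forall (i : 'I_n) (k : 'I_m), th (x 0 i - w k) != 0].
Proof.
rewrite /generic_set /generic_val /= !mulf_eq0 !negb_or.
move=> /and3P[l0 /prodf_neq0 xx /prodf_neq0 xw]; split => //.
- by move=> i j ij; exact: (xx (i, j)).
- by move=> i k; exact: (xw (i, k)).
Qed.

Lemma generic_open : open generic_set.
Proof.
have cont : continuous generic_val.
  apply: continuous_mulf; first by apply: continuous_thetaf => //; exact: lam_continuous.
  apply: continuous_mulf; apply: continuous_prodf => ij; apply: continuous_thetaf => //;
    apply: continuous_addf; try exact: coord_continuous.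
  - by apply: continuous_oppf; exact: coord_continuous.
  - exact: continuous_cstf.
rewrite (_ : generic_set = generic_val @^-1` (~` [set 0])).
  apply: open_comp; first by move=> x _; exact: cont.
  apply: closed_openC; apply: accessible_closed_set1.
  by apply: hausdorff_accessible; exact: norm_hausdorff.
by apply/seteqP; split => x /= => [/eqP|/eqP].
Qed.

(** On the line through [p] with direction [(1, ..., n)] all the arguments of theta
    are affine functions with non-zero slope. *)
Lemma generic_dense : (0 < n)%N -> dense generic_set.
Proof.
move=> n0 O [p Op] Oopen.
pose v : 'rV[C]_n := \row_i (i.+1%:R).
have cg : continuous (fun t : C => p + t *: v : 'rV[C]_n).
  move=> t; apply: (@cvgD _ _ _ (nbhs t) (nbhs_filter t) (fun=> p) (fun s => s *: v)).
    exact: cvg_cst.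
  exact: (@scalel_continuous C 'rV[C]_n v t).
have : nbhs (0 : C) ((fun t : C => p + t *: v) @^-1` O).
  by apply: cg; rewrite scale0r addr0; exact: open_nbhs_nbhs.
move=> /nbhs_ballP[d d0 dO].
have dE : d = (complex.Re d)%:C := real_of_ge0 (ltW d0).
have d0' : 0 < complex.Re d by rewrite -ltcR -dE.
pose s : seq (C * C) := (lam z p, - \sum_(i < n) i.+1%:R) ::
  [seq (p 0 ij.1 - p 0 ij.2, ij.1.+1%:R - ij.2.+1%:R) | ij <- enum {: 'I_n * 'I_n} & ij.1 != ij.2]
  ++ [seq (p 0 ik.1 - w ik.2, ik.1.+1%:R) | ik <- enum {: 'I_n * 'I_m}].
have [|t [t0 td ts]] := @theta_line_neq0 R tau tau_gt0 s (complex.Re d) _ d0'.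
  move=> q; rewrite inE mem_cat => /orP[/eqP->|/orP[/mapP[ij]|/mapP[ik _ ->]]] /=.
  - rewrite oppr_eq0 -natr_sum pnatr_eq0 -lt0n.
    by rewrite (bigD1 (Ordinal n0))//= addn_gt0.
  - rewrite mem_filter => /andP[ij12 _] -> /=; rewrite subr_eq0 eqr_nat eqSS.
    exact: ij12.
  - by rewrite pnatr_eq0.
exists (p + t%:C *: v); split.
  apply: dO; rewrite /ball /= sub0r normrN ger0_norm ?lecR ?(ltW t0)//.
  by rewrite dE ltcR.
rewrite /generic_set /generic_val /= !mulf_neq0//.
- have := ts _ (mem_head _ _); rewrite /= /lam mulrN -opprD mulr_sumr -big_split /=.
  apply: etrans; congr (th (- _) != 0); apply: eq_bigr => k _; rewrite !mxE; ring.
- apply/prodf_neq0 => ij ij12.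
  have := ts (p 0 ij.1 - p 0 ij.2, ij.1.+1%:R - ij.2.+1%:R); rewrite !mxE.
  rewrite (_ : p 0 ij.1 + t%:C * ij.1.+1%:R - (p 0 ij.2 + t%:C * ij.2.+1%:R)
    = p 0 ij.1 - p 0 ij.2 + t%:C * (ij.1.+1%:R - ij.2.+1%:R)); last by ring.
  apply; rewrite inE mem_cat; apply/orP; right; apply/orP; left.
  by apply/mapP; exists ij => //; rewrite mem_filter ij12 mem_enum.
- apply/prodf_neq0 => ik _.
  have := ts (p 0 ik.1 - w ik.2, ik.1.+1%:R); rewrite !mxE.
  rewrite (addrAC (p 0 _)); apply; rewrite inE mem_cat; apply/orP; right; apply/orP; right.
  by apply/mapP; exists ik => //; rewrite mem_enum.
Qed.

Lemma bethe_vector_neq0 x : generic_set x -> bethe_vector x != 0.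
Proof.
move=> /generic_setP[_ _ xw]; apply/prodf_neq0 => i _.
by rewrite mulf_neq0 ?cexp_neq0//; apply/prodf_neq0.
Qed.

Local Notation T_opp := (transfer_opp tau eta z Lambda).

Lemma transfer_continuous u x : continuous (fun y : C => T_opp y u x).
Proof.
have cid : continuous (fun y : C => y) by move=> y; exact: cvg_id.
apply: continuous_sumf => i; apply: continuous_mulf; last exact: continuous_cstf.
apply: continuous_mulf.
  apply: continuous_mulf; last exact: continuous_cstf.
  apply: (continuous_thetaf tau_gt0).
  apply: continuous_addf; last exact: continuous_cstf.
  apply: continuous_addf; first exact: continuous_cstf.
  exact: (continuous_oppf cid).
apply: continuous_prodf => j; apply: continuous_mulf; last exact: continuous_cstf.
apply: (continuous_thetaf tau_gt0).
apply: continuous_addf; [exact: cid|exact: continuous_cstf].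
Qed.

(** For generic [y] both sides are the same multiple of [bethe_vector x *
    bethe_vector x']; by continuity in [y] the equality holds for all [y]. *)
Lemma transfer_proportional (bethe : bethe_equations tau eta z Lambda a w)
    (sumLambda : (\sum_(k < n) Lambda k = 2 * m)%N)
    (w_sep : forall i j : 'I_m, i != j -> th (w i - w j) != 0) y x x' :
  generic_set x -> generic_set x' ->
  T_opp y bethe_vector x * bethe_vector x' = T_opp y bethe_vector x' * bethe_vector x.
Proof.
move=> /generic_setP[lx xx xw] /generic_setP[lx' xx' xw'].
pose f h := T_opp (y + h) bethe_vector x * bethe_vector x'
  - T_opp (y + h) bethe_vector x' * bethe_vector x.
pose s := [seq y - x 0 i | i <- enum 'I_n] ++ [seq y - x' 0 i | i <- enum 'I_n]
  ++ [seq y - w k | k <- enum 'I_m].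
suff : f 0 = 0 by rewrite /f addr0 => /eqP; rewrite subr_eq0 => /eqP.
apply: (@eq0_of_generic R tau tau_gt0 f s).
  have cT u x1 : continuous (fun h : C => T_opp (y + h) u x1).
    move=> h; apply: (@continuous_comp _ _ _ (fun h : C => y + h) (fun y => T_opp y u x1)).
      by apply: continuous_addf; [exact: continuous_cstf|move=> t; exact: cvg_id].
    exact: transfer_continuous.
  move: (0 : C); apply: continuous_addf.
    by apply: continuous_mulf => //; exact: continuous_cstf.
  by apply: continuous_oppf; apply: continuous_mulf => //; exact: continuous_cstf.
move=> h hs.
have yx i : th (y + h - x 0 i) != 0.
  rewrite addrAC; apply: hs; rewrite !mem_cat; apply/orP; left.
  by apply: (map_f (fun i => y - x 0 i)); rewrite mem_enum.
have yx' i : th (y + h - x' 0 i) != 0.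
  rewrite addrAC; apply: hs; rewrite !mem_cat; apply/orP; right; apply/orP; left.
  by apply: (map_f (fun i => y - x' 0 i)); rewrite mem_enum.
have yw k : th (y + h - w k) != 0.
  rewrite addrAC; apply: hs; rewrite !mem_cat; apply/orP; right; apply/orP; right.
  by apply: (map_f (fun k => y - w k)); rewrite mem_enum.
rewrite /f (transfer_generic tau_gt0 bethe sumLambda w_sep xx xw yx yw lx).
rewrite (transfer_generic tau_gt0 bethe sumLambda w_sep xx' xw' yx' yw lx').
by rewrite -/(bethe_vector x) -/(bethe_vector x') mulrAC subrr.
Qed.

End Eigenfunction.

Theorem proposition3p4 (R : realType) (n m : nat)
  (tau eta : Cplx R) (tau_gt0 : 0 < complex.Im tau)
  (z : 'I_n -> Cplx R) (z_inj : injective z)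
  (Lambda : 'I_n -> nat)
  (m_gt0 : (0 < m)%N) (sumLambda : (\sum_(k < n) Lambda k = 2 * m)%N)
  (a : Cplx R) (w : 'I_m -> Cplx R)
  (bethe : bethe_equations tau eta z Lambda a w)
  (w_neq : forall i j : 'I_m, i != j -> ~ lattice tau (w i - w j)) :
  common_eigenfunction tau eta z Lambda
    (fun x : 'rV[Cplx R]_n => \prod_(i < n) Qfun tau a w (x 0 i)).
Proof.
have n_gt0 : (0 < n)%N.
  rewrite lt0n; apply/eqP => n0; move: sumLambda; rewrite big1.
    by move/eqP; rewrite eq_sym muln_eq0 /= -leqn0 leqNgt m_gt0.
  by move=> [i i_lt]; exfalso; move: i_lt; rewrite n0.
have w_sep (i j : 'I_m) : i != j -> theta tau (w i - w j) != 0.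
  by move=> ij; apply/eqP => /(theta_eq0_lattice tau_gt0); exact: w_neq.
have gen_dense := generic_dense z w tau_gt0 n_gt0.
have gen_open : open (generic_set tau z w) by exact: generic_open.
have [x0 [_ gx0]] : [set: 'rV[Cplx R]_n] `&` generic_set tau z w !=set0.
  by apply: gen_dense; [exists 0|exact: openT].
split.
- exact: bethe_vector_meromorphic.
- move=> [V [Vo Vd V0]].
  have [x [gx Vx]] := Vd _ (ex_intro _ x0 gx0) gen_open.
  by have /eqP := bethe_vector_neq0 a gx; apply; exact: V0.
- exists (fun y => transfer_opp tau eta z Lambda (- y) (bethe_vector tau a w) x0
                   / bethe_vector tau a w x0) => y.
  exists (generic_set tau z w); split => // x gx.
  rewrite mulrAC -(transfer_proportional tau_gt0 bethe sumLambda w_sep _ gx gx0).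
  by rewrite mulfK//; exact: bethe_vector_neq0 gx0.
Qed.
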